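(* Let $w\in L^1(\mathbb{T};d\mathbf{m})$ satisfy $w(z)\ge 1$, let $dM(z)=w(z)\,d\mathbf{m}(z)$, and let $$t_n=\int_{\mathbb{T}}z^{-n}\,dM(z),\qquad n\in\mathbb{Z}.$$ Suppose that $w$ is a Muckenhoupt weight. Let the form $$t[g,g]=\sum_{n,m\ge0}t_{n-m}\,g_m\,\overline{g_n}$$ be defined on the set $\mathcal{D}\subset\ell^2(\mathbb{Z}_+)$ of sequences with only finitely many non-zero components. Then the closure of this form in $\ell^2(\mathbb{Z}_+)$ is given by the equality $$t[g,g]=\int_{\mathbb{T}}|(\mathcal{A}g)(z)|^2\,dM(z)$$ on the set $\mathcal{D}[t]$ of all $g\in\ell^2(\mathbb{Z}_+)$ such that the right-hand side of this equality is finite, where $(\mathcal{A}g)(z)=\sum_{n=0}^\infty g_n z^n$.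
   Context: $\mathbb{Z}_+=\{0,1,2,\ldots\}$; $\mathbf{m}$ is the normalized Lebesgue measure on the unit circle $\mathbb{T}$. For $g=\{g_n\}\in\ell^2(\mathbb{Z}_+)$ the series $\mathcal{A}g$ converges in $L^2(\mathbb{T};d\mathbf{m})$ and defines an element of the Hardy space $H^2(\mathbb{T};d\mathbf{m})$. Muckenhoupt weight: $w$ is a Muckenhoupt weight if $$\sup_{X\subset\mathbb{T}}\ \mathbf{m}(X)^{-2}\int_X w(z)\,d\mathbf{m}(z)\int_X w(z)^{-1}\,d\mathbf{m}(z)<\infty,$$ where $X$ runs over all subarcs of $\mathbb{T}$. Equivalently, the orthogonal projection $P_+$ of $L^2(\mathbb{T};d\mathbf{m})$ onto $H^2(\mathbb{T};d\mathbf{m})$ is bounded as an operator $L^2(\mathbb{T};dM)\to L^2(\mathbb{T};dM)$, $dM=w\,d\mathbf{m}$. Closure of a form: let $t[g,g]\ge\|g\|^2$ be a quadratic form on a dense linear subset $\mathcal{D}$ of a Hilbert space $\mathcal{H}$ and put $\|g\|_T=\sqrt{t[g,g]}$. The form is closable if $g^{(k)}\in\mathcal{D}$, $\|g^{(k)}\|\to0$ and $\|g^{(k)}-g^{(l)}\|_T\to0$ as $k,l\to\infty$ imply $\|g^{(k)}\|_T\to0$. In this case the completion $\mathcal{D}[t]$ of $\mathcal{D}$ in the norm $\|\cdot\|_T$ is realized as a subset of $\mathcal{H}$: it consists of the limits in $\mathcal{H}$ of all $\|\cdot\|_T$-Cauchy sequences in $\mathcal{D}$. The closure of the form is its extension by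 continuity to $\mathcal{D}[t]$. The form in the claim is closable because $M$ is absolutely continuous. *)

(* Defs.v *)
From HB Require Import structures.
From mathcomp Require Import all_boot all_order all_algebra.
From mathcomp Require Import complex.
From mathcomp Require Import all_classical all_reals all_analysis.
Set Implicit Arguments.
Unset Strict Implicit.
Unset Printing Implicit Defensive.
Import Order.TTheory GRing.Theory Num.Theory numFieldNormedType.Exports.
Local Open Scope classical_set_scope.
Local Open Scope ring_scope.
Local Open Scope complex_scope.

(* Modulus of a complex number as an element of R: the norm `|z| of R[i] is
   itself complex-valued. *)
Definition cabs (R : realType) (z : R[i]) : R := complex.Re `|z|.

(* The unit circle is parametrized by circ x = e^(2 i pi x), 0 <= x < 1.
   Functions on the circle are functions on R[i], of which only the values at
   points of modulus 1 matter. *)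
Definition circ (R : realType) (x : R) : R[i] :=
  cos (2 * pi * x) +i* sin (2 * pi * x).

Definition circle (R : realType) : set R[i] := [set z | cabs z = 1].
Arguments circle : clear implicits.

Definition circle_param (R : realType) (X : set R[i]) : set R :=
  `[0, 1[ `&` circ (R := R) @^-1` X.

(* Normalized Lebesgue measure on the circle: the image of Lebesgue measure on
   [0, 1[ under circ. *)
Definition circle_measure (R : realType) (X : set R[i]) : \bar R :=
  lebesgue_measure (circle_param X).

Definition circle_integral (R : realType) (X : set R[i]) (f : R[i] -> R) :
    \bar R :=
  (\int[lebesgue_measure]_(x in circle_param X) (f (circ x))%:E)%E.

Definition circle_measurable (R : realType) (f : R[i] -> R) : Prop :=
  measurable_fun (circle_param (circle R)) (f \o circ (R := R)).

Definition circle_integrable (R : realType) (f : R[i] -> R) : Prop :=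
  lebesgue_measure.-integrable (circle_param (circle R))
    (fun x : R => (f (circ x))%:E).

Definition circle_ae (R : realType) (P : R[i] -> Prop) : Prop :=
  {ae lebesgue_measure, forall x : R, circle_param (circle R) x -> P (circ x)}.

Definition circle_cintegral (R : realType) (f : R[i] -> R[i]) : R[i] :=
  fine (circle_integral (circle R) (fun z => complex.Re (f z))) +i*
  fine (circle_integral (circle R) (fun z => complex.Im (f z))).

(* All subarcs: open, closed, half-open, degenerate, or the whole circle. *)
Definition is_arc (R : realType) (X : set R[i]) : Prop :=
  exists I : set R, is_interval I /\ X = circ (R := R) @` I.

(* Arcs of measure zero are excluded, m(X)^-2 being undefined for them. *)
Definition muckenhoupt (R : realType) (w : R[i] -> R) : Prop :=
  (ereal_sup [set ((fine (circle_measure X) ^- 2)%R%:E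
                   * circle_integral X w
                   * circle_integral X (fun z => ((w z)^-1)%R))
             | X in [set X : set R[i] | is_arc X /\ 0 < circle_measure X]]
   < +oo)%E.

Definition l2sq (R : realType) (g : nat -> R[i]) : \bar R :=
  (\sum_(0 <= n <oo) (cabs (g n) ^+ 2)%:E)%E.

Definition l2 (R : realType) : set (nat -> R[i]) :=
  [set g | (l2sq g < +oo)%E].
Arguments l2 : clear implicits.

Definition seqB (R : realType) (g h : nat -> R[i]) : nat -> R[i] :=
  fun n => g n - h n.

Definition l2_cvg (R : realType) (u : nat -> nat -> R[i]) (g : nat -> R[i]) :
    Prop :=
  l2sq (seqB (u k) g) @[k --> \oo] --> 0%E.

(* A form is given by its diagonal values q g = t[g,g], for g in its domain D.
   The bound t[g,g] >= ||g||^2 includes the requirement that t[g,g] be real. *)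
Definition semibounded_form (R : realType) (D : set (nat -> R[i]))
    (q : (nat -> R[i]) -> R[i]) : Prop :=
  forall g, D g ->
    complex.Im (q g) = 0 /\ (l2sq g <= (complex.Re (q g))%:E)%E.

Definition form_norm (R : realType) (q : (nat -> R[i]) -> R[i])
    (g : nat -> R[i]) : R :=
  Num.sqrt (complex.Re (q g)).

Definition form_cauchy (R : realType) (q : (nat -> R[i]) -> R[i])
    (u : nat -> nat -> R[i]) : Prop :=
  forall eps : R, 0 < eps -> exists N : nat, forall k l : nat,
    (N <= k)%N -> (N <= l)%N -> form_norm q (seqB (u k) (u l)) < eps.

Definition closable_form (R : realType) (D : set (nat -> R[i]))
    (q : (nat -> R[i]) -> R[i]) : Prop :=
  forall u : nat -> nat -> R[i], (forall k, D (u k)) ->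
    l2_cvg u (fun=> 0) -> form_cauchy q u ->
    form_norm q (u k) @[k --> \oo] --> (0 : R).

Definition closure_approx (R : realType) (D : set (nat -> R[i]))
    (q : (nat -> R[i]) -> R[i]) (u : nat -> nat -> R[i]) (g : nat -> R[i]) :
    Prop :=
  [/\ forall k, D (u k), form_cauchy q u & l2_cvg u g].

Definition closure_domain (R : realType) (D : set (nat -> R[i]))
    (q : (nat -> R[i]) -> R[i]) : set (nat -> R[i]) :=
  [set g | l2 R g /\ exists u, closure_approx D q u g].

(* The form q on D is semibounded and closable, and its closure is the form q'
   with domain D': the extension of q by continuity to the completion of D. *)
Definition is_form_closure (R : realType) (D : set (nat -> R[i]))
    (q : (nat -> R[i]) -> R[i]) (D' : set (nat -> R[i]))
    (q' : (nat -> R[i]) -> R[i]) : Prop :=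
  [/\ semibounded_form D q,
      closable_form D q,
      closure_domain D q = D' &
      forall g u, D' g -> closure_approx D q u g ->
        cabs (q (u k) - q' g) @[k --> \oo] --> (0 : R)].

Definition finite_seqs (R : realType) : set (nat -> R[i]) :=
  [set g | finite_set [set n | g n != 0]].
Arguments finite_seqs : clear implicits.

(* f is a representative of the sum, in L^2 of the circle, of the series
   \sum_n g_n z^n. *)
Definition is_L2_sum (R : realType) (g : nat -> R[i]) (f : R[i] -> R[i]) :
    Prop :=
  [/\ circle_measurable (fun z => complex.Re (f z)),
      circle_measurable (fun z => complex.Im (f z)) &
      circle_integral (circle R)
        (fun z => cabs (f z - \sum_(n < N) g n * z ^+ n) ^+ 2)
        @[N --> \oo] --> 0%E].

(* The series converges for g in l2; its sum is defined only up to equality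
   almost everywhere, and calA g is one representative of it. *)
Definition calA (R : realType) (g : nat -> R[i]) : R[i] -> R[i] :=
  xget (fun=> 0) [set f | is_L2_sum g f].

(* t_n for dM = w dm *)
Definition moment (R : realType) (w : R[i] -> R) (n : int) : R[i] :=
  circle_cintegral (fun z => z ^ (- n) * (w z)%:C).

(* The sum is meaningful only when it has finitely many non-zero terms, in
   particular for g in finite_seqs. *)
Definition toeplitz_form (R : realType) (w : R[i] -> R) (g : nat -> R[i]) :
    R[i] :=
  \sum_(p \in [set: nat * nat])
    moment w (p.1%:Z - p.2%:Z) * g p.2 * (g p.1)^*.

(* The integral of |calA g|^2 with respect to dM = w dm *)
Definition analytic_energy (R : realType) (w : R[i] -> R) (g : nat -> R[i]) :
    \bar R :=
  circle_integral (circle R) (fun z => cabs (calA g z) ^+ 2 * w z).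

(* Main.v *)
(* The closure in question is controlled by the energy int |f|^2 dM of analytic
   polynomials f.  Since w >= 1, convergence in the form norm implies convergence
   in L^2(m), and truncating w at height n shows that form-Cauchy sequences that
   converge to f = A g in L^2(m) also converge to f in L^2(M).  This gives
   closability, one inclusion of domains, and the formula for the closed form.

   For the other inclusion let f = A g have finite energy.  The averages
   N int_x^(x+1/N) f(e^(2 i pi t)) dt multiply the n-th coefficient by a factor
   c_(N,n) which is bounded and tends to 1.  For x in the cell
   [j/N, (j+1)/N[ the average only involves f on an arc of length 2/N, so
   Cauchy-Schwarz and the Muckenhoupt condition for that arc bound the energy of
   the average over the cell by that of f over the arc; summing over j, the
   averages have bounded energy.  Replacing f by a long enough partial sum of A g
   gives polynomials of bounded energy whose coefficients converge to g in l^2,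
   and near-minimizers of the energy in shrinking neighbourhoods of g are
   form-Cauchy by the parallelogram law. *)
Require Import Defs.
From HB Require Import structures.
From mathcomp Require Import all_boot all_order all_algebra.
From mathcomp Require Import complex.
From mathcomp Require Import all_classical all_reals all_analysis.
From mathcomp Require Import measurable_realfun.
From mathcomp Require Import ring lra.
Set Implicit Arguments.
Unset Strict Implicit.
Unset Printing Implicit Defensive.
Import Order.TTheory GRing.Theory Num.Theory numFieldNormedType.Exports.
Local Open Scope classical_set_scope.
Local Open Scope ring_scope.
Local Open Scope complex_scope.

(** * Complex moduli and the parametrization of the circle *)

Section circ.
Context {R : realType}.
Implicit Types (x y : R) (z u v : R[i]).
Local Notation Re := complex.Re.
Local Notation Im := complex.Im.

(** Partial sums of A g converge to f only in L^2(m), and their energies need not stay bounded. The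
    average is therefore applied to a partial sum of length M, where M is chosen after N so that the
    partial sum is within 1/N of f in L^1(m). Averaging costs a factor N, so this error shifts the
    averages by a bounded amount only, and it enters the energy as a multiple of the integral of w,
    which is finite.

    Boundedness of the energies is all that is asked of the averages. The choice of near-minimizers
    does the work of a weak compactness argument: from approximants of bounded energy that converge
    in l^2 it produces approximants that are Cauchy in the form norm. This is why crude averages
    over arcs of length 1/N can be used. *)

Definition sqmod z : R := Re z ^+ 2 + Im z ^+ 2.

Lemma sqmod_ge0 z : 0 <= sqmod z.
Proof. by rewrite addr_ge0 ?sqr_ge0. Qed.

Lemma cabs_sqrt z : cabs z = Num.sqrt (sqmod z).
Proof. by rewrite /cabs normc_def. Qed.

Lemma cabs_sqr z : cabs z ^+ 2 = sqmod z.
Proof. by rewrite cabs_sqrt sqr_sqrtr ?sqmod_ge0. Qed.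

Lemma cReD u v : Re (u + v) = Re u + Re v. Proof. by case: u; case: v. Qed.
Lemma cImD u v : Im (u + v) = Im u + Im v. Proof. by case: u; case: v. Qed.
Lemma cReN u : Re (- u) = - Re u. Proof. by case: u. Qed.
Lemma cImN u : Im (- u) = - Im u. Proof. by case: u. Qed.
Lemma cReM u v : Re (u * v) = Re u * Re v - Im u * Im v.
Proof. by case: u; case: v. Qed.
Lemma cImM u v : Im (u * v) = Re u * Im v + Im u * Re v.
Proof. by case: u; case: v. Qed.
Definition cReImE := (cReD, cImD, cReN, cImN, cReM, cImM).

Lemma cRe_sum (I : Type) (r : seq I) (P : pred I) (F : I -> R[i]) :
  Re (\sum_(i <- r | P i) F i) = \sum_(i <- r | P i) Re (F i).
Proof. by elim/big_rec2: _ => //= i a b _ <-; rewrite cReD. Qed.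
Lemma cIm_sum (I : Type) (r : seq I) (P : pred I) (F : I -> R[i]) :
  Im (\sum_(i <- r | P i) F i) = \sum_(i <- r | P i) Im (F i).
Proof. by elim/big_rec2: _ => //= i a b _ <-; rewrite cImD. Qed.

Lemma sqmodM u v : sqmod (u * v) = sqmod u * sqmod v.
Proof. by rewrite /sqmod !cReImE; ring. Qed.

Lemma eq_complex_parts z u : Re z = Re u -> Im z = Im u -> z = u.
Proof. by case: z; case: u => /= a b c d -> ->. Qed.

Lemma circD x y : circ (x + y) = circ x * circ y.
Proof.
by apply: eq_complex_parts; rewrite !cReImE /circ/= mulrDr ?cosD ?sinD//; ring.
Qed.

Lemma circ0 : circ (0 : R) = 1.
Proof. by rewrite /circ mulr0 cos0 sin0. Qed.

Lemma circ1 : circ (1 : R) = 1.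
Proof. by rewrite /circ mulr1 mulr_natl cos2pi sin2pi. Qed.

Lemma circX x n : circ x ^+ n = circ (n%:R * x).
Proof.
elim: n => [|n IH]; first by rewrite expr0 mul0r circ0.
by rewrite exprS IH -circD -[in n.+1%:R]add1n natrD mulrDl mul1r.
Qed.

Lemma sqmod_circ x : sqmod (circ x) = 1.
Proof. by rewrite /sqmod /circ/= cos2Dsin2. Qed.

Lemma conj_circ x : (circ x)^* = circ (- x).
Proof. by rewrite /circ mulrN cosN sinN. Qed.

Lemma circVN x : (circ x)^-1 = circ (- x).
Proof.
have H : circ x * circ (- x) = 1 by rewrite -circD subrr circ0.
by apply: (@mulrI _ (circ x)); rewrite ?H ?divrr ?unitfE//;
  apply/negP => /eqP h; move: H; rewrite h mul0r => /eqP; rewrite eq_sym oner_eq0.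
Qed.

Lemma circ_exprz x (k : int) : circ x ^ k = circ (k%:~R * x).
Proof.
case: k => n; first by rewrite -circX.
by rewrite -[LHS]/(circ x ^- n.+1) circX circVN NegzE mulrNz mulNr.
Qed.

Lemma circle_paramE : circle_param (circle R) = `[0, 1[%classic.
Proof.
rewrite /circle_param; apply/seteqP; split => x /=; first by case.
by move=> h; split => //; rewrite /circle/= cabs_sqrt sqmod_circ sqrtr1.
Qed.

(** If x < y had the same image, then cos (2 s) = 1 - 2 sin^2 s would equal 1 for s = pi (y - x),
    while s lies in ]0, pi[, where the sine is positive. *)
Lemma circ_inj : {in `[0%R, 1%R[ &, injective (circ (R := R))}.
Proof.
move=> x y xI yI xy.
wlog lexy : x y xI yI xy / x <= y.
  by move=> H; have [/H|/ltW/H/esym] := leP x y; [exact|apply].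
have c1 : circ (y - x) = 1 by rewrite circD -xy -circD subrr circ0.
move: xI yI; rewrite !in_itv/= => /andP[x0 x1] /andP[y0 y1].
have [//|ltxy] := eqVneq x y.
have xy' : x < y by rewrite lt_neqAle ltxy.
have s0 : 0 < sin (pi * (y - x)).
  by apply: sin_gt0_pi; rewrite ?mulr_gt0 ?pi_gt0 ?subr_gt0// gtr_pMr ?pi_gt0//; lra.
have : cos (2 * pi * (y - x)) = 1 by have := congr1 (@complex.Re R) c1.
rewrite (_ : 2 * pi * (y - x) = pi * (y-x) + pi * (y-x)); last by ring.
rewrite cosD -!expr2 cos2sin2 => h.
by have := exprn_gt0 2 s0; lra.
Qed.

End circ.

(** * Antiderivatives of the characters e^(2 i pi r x) *)

Section antiderivative.
Context {R : realType}.
Implicit Types (x y r : R) (z u v : R[i]).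
Local Notation mu := (@lebesgue_measure R).
Local Notation Re := (@complex.Re R).
Local Notation Im := (@complex.Im R).

Lemma integral_is_derive (f F : R -> R) a b : a <= b -> continuous f ->
  (forall x, is_derive x 1 F (f x)) ->
  (\int[mu]_(x in `[a, b[) (f x)%:E = (F b - F a)%:E)%E.
Proof.
rewrite le_eqVlt => /predU1P[<- _ _|ab cf dF].
  by rewrite set_itvco0// integral_set0 subrr.
have cF : continuous F.
  by move=> x; apply/differentiable_continuous/derivable1_diffP; case: (dF x).
rewrite integral_itv_bndo_bndc; last first.
  apply/measurable_EFinP; apply: (measurable_funS measurableT) => //.
  exact: continuous_measurable_fun.
rewrite (@continuous_FTC2 _ f F) //.
- by apply: continuous_subspaceT => x; exact: cf.
- split.
  + by move=> x _; case: (dF x).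
  + by apply: cvg_at_right_filter; exact: cF.
  + by apply: cvg_at_left_filter; exact: cF.
- by move=> x _; rewrite derive1E; have [_ ->] := dF x.
Qed.

(** The antiderivative e^(2 i pi r x) / (2 i pi r) of [circ (r * x)], replaced by x when r = 0. *)
Definition circ_prim r x : R[i] :=
  if r == 0 then x%:C else circ (r * x) * (0 -i* (2 * pi * r)^-1).

(** Stated for increments, because the antiderivative itself is not periodic when r = 0. With c = 1
    it brings intervals beyond 1 back into [0, 1[. *)
Lemma circ_prim_shift r x y (c : R) : circ (r * c) = 1 ->
  circ_prim r (x + c) - circ_prim r (y + c) = circ_prim r x - circ_prim r y.
Proof.
rewrite /circ_prim => c1; case: ifPn => _; last first.
  by rewrite !mulrDr !circD c1 !mulr1.
by apply: eq_complex_parts; rewrite !cReImE/=; ring.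
Qed.

(** The increment over a step h is the character times a constant that depends on h alone. This is
    what makes averaging a coefficientwise multiplication. *)
Lemma circ_primB r x h :
  circ_prim r (x + h) - circ_prim r x =
  circ (r * x) * (circ_prim r h - circ_prim r 0).
Proof.
rewrite /circ_prim; case: ifPn => [/eqP ->|_]; last first.
  by rewrite mulrDr circD mulr0 circ0; ring.
by rewrite mul0r circ0; apply: eq_complex_parts; rewrite !cReImE/=; ring.
Qed.

Lemma is_derive_Re_circ_prim r x :
  is_derive x (1 : R) (fun t => Re (circ_prim r t)) (Re (circ (r * x))).
Proof.
rewrite /circ_prim; have [->|r0] := eqVneq r 0.
  by rewrite mul0r circ0/=; exact: is_derive_id.
have p0 : 2 * pi * r != 0 :> R by rewrite !mulf_neq0// gt_eqF// pi_gt0.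
rewrite (_ : (fun t => _) = fun t => (2 * pi * r)^-1 * sin (2 * pi * r * t)); last first.
  by apply/funext => t; rewrite cReM/= mulr0 mulrN opprK add0r mulrC !mulrA.
apply: is_derive_eq.
rewrite -[LHS]/(_ * (_ * (_ * 1))) mulr1 mulrCA mulVf// mulr1.
by rewrite /circ/= mulrA.
Qed.

Lemma is_derive_Im_circ_prim r x :
  is_derive x (1 : R) (fun t => Im (circ_prim r t)) (Im (circ (r * x))).
Proof.
rewrite /circ_prim; have [->|r0] := eqVneq r 0.
  by rewrite mul0r circ0/=; exact: is_derive_cst.
have p0 : 2 * pi * r != 0 :> R by rewrite !mulf_neq0// gt_eqF// pi_gt0.
rewrite (_ : (fun t => _) = fun t => - (2 * pi * r)^-1 * cos (2 * pi * r * t));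
  last first.
  by apply/funext => t; rewrite cImM/= mulr0 addr0 mulrC !mulrA.
apply: is_derive_eq.
rewrite -[LHS]/(_ * (_ * (_ * 1))) mulr1 !mulNr mulrN opprK mulrCA mulVf// mulr1.
by rewrite /circ/= mulrA.
Qed.

Lemma continuous_Re_circ r : continuous (fun x : R => Re (circ (r * x))).
Proof.
move=> x; rewrite /circ/=; apply: (continuous_comp (f := fun x => 2 * pi * (r * x)))
  => /=.
  by apply: cvgMr; apply: cvgMr; exact: cvg_id.
exact: continuous_cos.
Qed.

Lemma continuous_Im_circ r : continuous (fun x : R => Im (circ (r * x))).
Proof.
move=> x; rewrite /circ/=; apply: (continuous_comp (f := fun x => 2 * pi * (r * x)))
  => /=.
  by apply: cvgMr; apply: cvgMr; exact: cvg_id.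
exact: continuous_sin.
Qed.

Lemma circ_nat n : circ (n%:R : R) = 1.
Proof. by rewrite -[n%:R]mulr1 -circX circ1 expr1n. Qed.

Lemma circ_int (k : int) : circ (k%:~R : R) = 1.
Proof. by rewrite -[k%:~R]mulr1 -circ_exprz circ1 exp1rz. Qed.

End antiderivative.

(** * Measurability and integration of complex-valued functions *)

Section complex_integral.
Context {R : realType}.
Implicit Types (F G : R -> R[i]) (D : set R).
Local Notation mu := (@lebesgue_measure R).
Local Notation Re := (@complex.Re R).
Local Notation Im := (@complex.Im R).

Definition cmeasurable D F :=
  measurable_fun D (Re \o F) /\ measurable_fun D (Im \o F).

Definition cintegrable D F :=
  mu.-integrable D (EFin \o (Re \o F)) /\ mu.-integrable D (EFin \o (Im \o F)).

Definition cintegral D F : R[i] :=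
  (\int[mu]_(x in D) Re (F x)) +i* (\int[mu]_(x in D) Im (F x)).

Lemma cmeasurable_cst D c : cmeasurable D (fun=> c).
Proof. by split; exact: measurable_cst. Qed.

Lemma cmeasurableD D F G :
  cmeasurable D F -> cmeasurable D G -> cmeasurable D (F \+ G).
Proof.
move=> [rF iF] [rG iG]; split.
  rewrite (_ : _ \o _ = (Re \o F) \+ (Re \o G)); first exact: measurable_funD.
  by apply/funext => x/=; rewrite cReD.
rewrite (_ : _ \o _ = (Im \o F) \+ (Im \o G)); first exact: measurable_funD.
by apply/funext => x/=; rewrite cImD.
Qed.

Lemma cmeasurableM D F G :
  cmeasurable D F -> cmeasurable D G -> cmeasurable D (fun x => F x * G x).
Proof.
move=> [rF iF] [rG iG]; split.
  rewrite (_ : _ \o _ = ((Re \o F) \* (Re \o G)) \- ((Im \o F) \* (Im \o G))).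
    by apply: measurable_funB; exact: measurable_funM.
  by apply/funext => x/=; rewrite cReM.
rewrite (_ : _ \o _ = ((Re \o F) \* (Im \o G)) \+ ((Im \o F) \* (Re \o G))).
  by apply: measurable_funD; exact: measurable_funM.
by apply/funext => x/=; rewrite cImM.
Qed.

Lemma cmeasurableB D F G :
  cmeasurable D F -> cmeasurable D G -> cmeasurable D (F \- G).
Proof.
move=> mF mG; rewrite (_ : F \- G = F \+ (fun x => - 1 * G x)).
  by apply: cmeasurableD => //; apply: cmeasurableM => //; exact: cmeasurable_cst.
by apply/funext => x/=; rewrite mulN1r.
Qed.

Lemma cmeasurable_sum D (I : Type) (s : seq I) (F : I -> R -> R[i]) :
  (forall i, cmeasurable D (F i)) -> cmeasurable D (fun x => \sum_(i <- s) F i x).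
Proof.
move=> mF; split.
  rewrite (_ : _ \o _ = fun x => \sum_(i <- s) Re (F i x)).
    by apply: measurable_sum => i; have [] := mF i.
  by apply/funext => x/=; rewrite cRe_sum.
rewrite (_ : _ \o _ = fun x => \sum_(i <- s) Im (F i x)).
  by apply: measurable_sum => i; have [] := mF i.
by apply/funext => x/=; rewrite cIm_sum.
Qed.

Lemma cmeasurable_circ D (r : R) : measurable D ->
  cmeasurable D (fun x => circ (r * x)).
Proof.
move=> mD; split; apply: (measurable_funS measurableT) => //;
  apply: continuous_measurable_fun.
- exact: continuous_Re_circ.
- exact: continuous_Im_circ.
Qed.

Lemma measurable_sqmod D F : cmeasurable D F ->
  measurable_fun D (fun x => sqmod (F x)).
Proof. by move=> [? ?]; apply: measurable_funD; exact: measurable_funX. Qed.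

Lemma integrableMr_cst D (f : R -> R) (k : R) : measurable D ->
  mu.-integrable D (EFin \o f) -> mu.-integrable D (fun x => (f x * k)%:E).
Proof.
move=> mD; rewrite [X in _ -> _.-integrable _ X](_ : _ = (EFin \o f) \* cst k%:E)%E//.
exact: integrableZr.
Qed.

Lemma cintegrableZ D F (c : R[i]) : measurable D -> cintegrable D F ->
  cintegrable D (fun x => F x * c).
Proof.
move=> mD [rF iF]; split.
  rewrite (_ : _ \o _ = (fun x => (Re (F x) * Re c)%:E) \-
                        (fun x => (Im (F x) * Im c)%:E))%E; last first.
    by apply/funext => x/=; rewrite cReM EFinB.
  by apply: integrableB => //; exact: integrableMr_cst.
rewrite (_ : _ \o _ = (fun x => (Re (F x) * Im c)%:E) \+
                      (fun x => (Im (F x) * Re c)%:E))%E; last first.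
  by apply/funext => x/=; rewrite cImM EFinD.
by apply: integrableD => //; exact: integrableMr_cst.
Qed.

Lemma cintegralZ D F (c : R[i]) : measurable D -> cintegrable D F ->
  cintegral D (fun x => F x * c) = cintegral D F * c.
Proof.
move=> mD [rF iF]; rewrite /cintegral; apply: eq_complex_parts; rewrite [LHS]/=.
  under [LHS]eq_Rintegral do rewrite cReM.
  by rewrite RintegralB ?RintegralZr ?cReM//; exact: integrableMr_cst.
under [LHS]eq_Rintegral do rewrite cImM.
by rewrite RintegralD ?RintegralZr ?cImM//; exact: integrableMr_cst.
Qed.

Lemma cintegrableD D F G : measurable D -> cintegrable D F -> cintegrable D G ->
  cintegrable D (F \+ G).
Proof.
move=> mD [rF iF] [rG iG]; split.
  rewrite (_ : _ \o _ = (EFin \o (Re \o F)) \+ (EFin \o (Re \o G)))%E.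
    exact: integrableD.
  by apply/funext => x/=; rewrite cReD EFinD.
rewrite (_ : _ \o _ = (EFin \o (Im \o F)) \+ (EFin \o (Im \o G)))%E.
  exact: integrableD.
by apply/funext => x/=; rewrite cImD EFinD.
Qed.

Lemma cintegralD D F G : measurable D -> cintegrable D F -> cintegrable D G ->
  cintegral D (F \+ G) = cintegral D F + cintegral D G.
Proof.
move=> mD [rF iF] [rG iG]; apply: eq_complex_parts; rewrite /cintegral/=.
  by under eq_Rintegral do rewrite cReD; rewrite RintegralD.
by under eq_Rintegral do rewrite cImD; rewrite RintegralD.
Qed.

Lemma cintegrable_sum D (I : Type) (s : seq I) (F : I -> R -> R[i]) :
  measurable D -> (forall i, cintegrable D (F i)) ->
  cintegrable D (fun x => \sum_(i <- s) F i x).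
Proof.
move=> mD iF; elim: s => [|i s IH].
  rewrite (_ : (fun x => _) = fun=> 0); last by apply/funext=> x; rewrite big_nil.
  by split; exact: integrable0.
rewrite (_ : (fun x => _) = F i \+ (fun x => \sum_(i <- s) F i x)).
  exact: cintegrableD.
by apply/funext=> x; rewrite big_cons.
Qed.

Lemma cintegral_sum D (I : Type) (s : seq I) (F : I -> R -> R[i]) :
  measurable D -> (forall i, cintegrable D (F i)) ->
  cintegral D (fun x => \sum_(i <- s) F i x) = \sum_(i <- s) cintegral D (F i).
Proof.
move=> mD iF; elim: s => [|i s IH].
  rewrite (_ : (fun x => _) = fun=> 0); last by apply/funext=> x; rewrite big_nil.
  by rewrite big_nil; apply: eq_complex_parts; rewrite /= Rintegral_cst// mul0r.
rewrite (_ : (fun x => _) = F i \+ (fun x => \sum_(i <- s) F i x)).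
  by rewrite cintegralD ?big_cons ?IH//; exact: cintegrable_sum.
by apply/funext=> x; rewrite big_cons.
Qed.

End complex_integral.

(** * The Toeplitz form as an integral *)

Section toeplitz.
Context {R : realType}.
Implicit Types (u : nat -> R[i]) (w : R[i] -> R).
Local Notation mu := (@lebesgue_measure R).
Local Notation D := (`[0%R, 1%R[%classic : set R).

Definition trig u N (x : R) : R[i] := \sum_(n < N) u n * circ x ^+ n.

Lemma cmeasurable_trig (A : set R) u N : measurable A -> cmeasurable A (trig u N).
Proof.
move=> mA; apply: cmeasurable_sum => n; apply: cmeasurableM.
  exact: cmeasurable_cst.
by under eq_fun do rewrite circX; exact: cmeasurable_circ.
Qed.

Lemma cintegrable_circM w (k : int) : circle_integrable w ->
  cintegrable D (fun x => circ x ^ k * (w (circ x))%:C).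
Proof.
rewrite /circle_integrable circle_paramE => iw.
have mD : measurable D by [].
have mw : measurable_fun D (fun x : R => w (circ x)).
  by apply/measurable_EFinP; apply: measurable_int iw.
have [m1 m2] : cmeasurable D (fun x => circ x ^ k * (w (circ x))%:C).
  rewrite (_ : (fun x => _) = fun x => circ (k%:~R * x) * (w (circ x))%:C).
    apply: cmeasurableM; first exact: cmeasurable_circ.
    by split => //; exact: measurable_cst.
  by apply/funext => x; rewrite circ_exprz.
split; (apply: le_integrable (iw) => //; first by apply/measurable_EFinP) => x _ /=;
  rewrite lee_fin circ_exprz ?cReM ?cImM /= mulr0 ?subr0 ?add0r normrM ler_piMl//.
  exact: cos_max.
exact: sin_max.
Qed.

Lemma momentE w k : moment w k = cintegral D (fun x => circ x ^ (- k) * (w (circ x))%:C).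
Proof. by rewrite /moment /circle_cintegral /circle_integral circle_paramE. Qed.

(** The squared modulus is the product with the conjugate, and conjugation on the circle is
    inversion, so the product of the two sums carries exactly the exponents of the moments. *)
Lemma sqmod_trig u K (x : R) (c : R) : (sqmod (trig u K x) * c)%:C =
  \sum_(p <- [seq (i, j) | i <- iota 0 K, j <- iota 0 K])
    circ x ^ (- (p.1%:Z - p.2%:Z)) * c%:C * (u p.2 * (u p.1)^*).
Proof.
rewrite big_allpairs/=.
transitivity (c%:C * (trig u K x * (trig u K x)^*)).
  rewrite -sqr_normc -add_Re2_Im2 /sqmod.
  by apply: eq_complex_parts; rewrite !cReImE/=; ring.
rewrite /trig -(big_mkord xpredT (fun n => u n * circ x ^+ n)) /index_iota subn0.
rewrite rmorph_sum/= mulr_suml mulr_sumr exchange_big/=.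
apply: eq_bigr => m _; rewrite !mulr_sumr; apply: eq_bigr => n _.
rewrite [X in _ * (_ * X)](_ : _ = (u n)^* * circ (- (n%:R * x))); last first.
  by rewrite circX [LHS]rmorphM; congr (_ * _); exact: conj_circ.
rewrite circ_exprz circX (_ : (- (n%:Z - m%:Z))%:~R * x = m%:R * x + - (n%:R * x)).
  by rewrite circD; ring.
by rewrite rmorphN rmorphB/= !pmulrn; ring.
Qed.

(** [sqmod_trig] is integrated term by term. Integrability is part of the conclusion because a
    real-valued integral does not record finiteness, which the later passage to extended reals
    requires. *)
Lemma toeplitz_formE w u K : circle_integrable w ->
  (forall n, (K <= n)%N -> u n = 0) ->
  toeplitz_form w u =
    (\int[mu]_(x in D) (sqmod (trig u K x) * w (circ x)))%:C /\
  mu.-integrable D (fun x => (sqmod (trig u K x) * w (circ x))%:E).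
Proof.
move=> iw u0; have mD : measurable D by [].
pose s := [seq (i, j) | i <- iota 0 K, j <- iota 0 K].
pose F (p : nat * nat) x := circ x ^ (- (p.1%:Z - p.2%:Z))
  * (w (circ x))%:C * (u p.2 * (u p.1)^*).
have iF p : cintegrable D (F p).
  by apply: cintegrableZ => //; exact: cintegrable_circM.
have FE : (fun x => (sqmod (trig u K x) * w (circ x))%:C) = fun x => \sum_(p <- s) F p x.
  by apply/funext => x; rewrite sqmod_trig.
have [iR _] : cintegrable D (fun x => (sqmod (trig u K x) * w (circ x))%:C).
  by rewrite FE; exact: cintegrable_sum.
split; last exact: iR.
transitivity (cintegral D (fun x => (sqmod (trig u K x) * w (circ x))%:C)); last first.
  by apply: eq_complex_parts => //=; rewrite Rintegral_cst// mul0r.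
(* The sum over all pairs reduces to the square of side K, since outside it one of the two factors
   of u vanishes. *)
rewrite FE cintegral_sum// /toeplitz_form (fsbigE s)//; last 2 first.
- by rewrite allpairs_uniq ?iota_uniq// => -[? ?] [? ?].
- move=> [i j] _ /= /negP ijs.
  have [/u0 ->|ltK] := leqP K i; first by rewrite rmorph0 mulr0.
  have [/u0 ->|ltK'] := leqP K j; first by rewrite mulr0 mul0r.
  by exfalso; apply: ijs; apply/allpairsP; exists (i, j); rewrite !mem_iota.
apply: eq_big => [p|p _]; first by rewrite mem_set.
by rewrite /F cintegralZ ?momentE ?mulrA//; exact: cintegrable_circM.
Qed.

Lemma Re_toeplitz_form w u K : circle_integrable w ->
  (forall n, (K <= n)%N -> u n = 0) ->
  ((complex.Re (toeplitz_form w u))%:E =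
    \int[mu]_(x in D) (sqmod (trig u K x) * w (circ x))%:E)%E.
Proof.
move=> iw u0; have [-> /= iu] := toeplitz_formE iw u0.
by rewrite /Rintegral fineK//; exact: integrable_fin_num.
Qed.

Lemma lebesgue_measure_co01 : (mu D = 1)%E.
Proof. by rewrite lebesgue_measure_itv/= lte_fin ltr01 sube0. Qed.

Lemma circle_integrable1 : circle_integrable (fun=> 1 : R).
Proof.
rewrite /circle_integrable circle_paramE; apply: measurable_bounded_integrable => //.
- exact: (eq_ind_r (fun z => (z < +oo)%E) (ltry 1) lebesgue_measure_co01).
- by exists 1; split => // x x1 y _ /=; rewrite normr1 ltW.
Qed.

Lemma cintegral_circ (r a b : R) : a <= b ->
  cintegral `[a, b[ (fun x => circ (r * x)) = circ_prim r b - circ_prim r a.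
Proof.
move=> ab; apply: eq_complex_parts; rewrite /cintegral /Rintegral.
  rewrite [LHS]/= (integral_is_derive ab (@continuous_Re_circ R r)
    (is_derive_Re_circ_prim r)).
  by rewrite cReD cReN.
rewrite [LHS]/= (integral_is_derive ab (@continuous_Im_circ R r)
  (is_derive_Im_circ_prim r)).
by rewrite cImD cImN.
Qed.

Lemma moment1 (k : int) : moment (fun=> 1 : R) k = (k == 0)%:R.
Proof.
rewrite momentE (_ : (fun x => _) = fun x => circ ((- k)%:~R * x)); last first.
  by apply/funext => x; rewrite circ_exprz mulr1.
rewrite cintegral_circ// /circ_prim intr_eq0 oppr_eq0; case: eqVneq => [_|k0].
  by apply: eq_complex_parts; rewrite !cReImE/= ?subr0// oppr0.
by rewrite mulr1 mulr0 circ_int circ0 subrr.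
Qed.

(** The Toeplitz form of the weight 1 is diagonal by [moment1]. It is evaluated at the truncation
    [v], which is supported below K as [Re_toeplitz_form] demands. *)
Lemma parseval u K :
  (\int[mu]_(x in D) (sqmod (trig u K x))%:E = (\sum_(n < K) sqmod (u n))%:E)%E.
Proof.
pose v n := if (n < K)%N then u n else 0.
have v0 n : (K <= n)%N -> v n = 0 by move=> Kn; rewrite /v ltnNge Kn.
have := Re_toeplitz_form circle_integrable1 v0.
have -> : (fun x => (sqmod (trig v K x) * 1)%:E) = (fun x => (sqmod (trig u K x))%:E).
  apply/funext => x; rewrite mulr1; congr (sqmod _)%:E.
  by apply: eq_bigr => i _; rewrite /v ltn_ord.
move=> <-; congr _%:E.
rewrite /toeplitz_form.
rewrite (fsbigE [seq (i, i) | i <- iota 0 K])//; last 2 first.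
- by rewrite map_inj_uniq ?iota_uniq// => ? ? [].
- move=> [i j] _ /= /negP ij; rewrite moment1; case: eqVneq => [|_];
  last by rewrite !mul0r.
  move/eqP; rewrite subr_eq0 => /eqP [ijE]; rewrite mul1r; move: ij; rewrite -ijE => ij.
  have [/v0 ->|ltK] := leqP K i; first by rewrite rmorph0 mulr0.
  by exfalso; apply: ij; apply/mapP; exists i; rewrite ?mem_iota.
rewrite big_map cRe_sum -(big_mkord xpredT (fun n => sqmod (u n))) /index_iota subn0.
rewrite [LHS]big_seq_cond [RHS]big_seq; apply: eq_big => [n|n].
  by rewrite mem_set// andbT.
rewrite mem_iota/= add0n => /andP[nK _]; rewrite subrr moment1 eqxx mul1r /v nK.
by rewrite -sqr_normc -add_Re2_Im2.
Qed.

End toeplitz.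

(** * Completeness of L^2 *)

Section L2.
Context {d : measure_display} {T : measurableType d} {R : realType}.
Variables (mu : {measure set T -> \bar R}) (D : set T).
Hypothesis mD : measurable D.

Lemma cvgn_telescope (u : R^nat) :
  (\sum_(0 <= n <oo) `|u n.+1 - u n|%:E < +oo)%E -> cvgn u.
Proof.
move=> uoo; set S := (\sum_(0 <= n <oo) _)%E in uoo.
have S0 : (0 <= S)%E by apply: nneseries_ge0 => n _ _; rewrite lee_fin.
have Sfin : S \is a fin_num by rewrite ge0_fin_numE.
have /normed_cvg : cvgn [normed series (telescope u)].
  apply: (@nondecreasing_is_cvgn _ _).
    by apply: nondecreasing_series => n _ _ /=.
  exists (fine S) => _ [n _ <-]; rewrite -lee_fin fineK//.
  rewrite /series/= -sumEFin.
  by apply: nneseries_lim_ge => i _ _; rewrite lee_fin.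
move=> cu; rewrite (funext (eq_sum_telescope u)).
by apply: is_cvgD => //; exact: is_cvg_cst.
Qed.

Lemma cvg_EFin_nat (u : R^nat) (l : R) : u @ \oo --> l -> (u n)%:E @[n --> \oo] --> l%:E.
Proof. by move=> ul; apply: cvg_EFin; [exact: nearW|exact: ul]. Qed.

Lemma limn_einf_le_cst (u : (\bar R)^nat) (c : \bar R) :
  (forall n, u n <= c)%E -> (limn_einf u <= c)%E.
Proof.
move=> uc; rewrite limn_einf_lim; apply: lime_le; first exact: is_cvg_einfs.
apply: nearW => n; apply: le_trans (uc n); apply: ereal_inf_lbound.
by exists n => /=.
Qed.

Lemma measurable_fun_limn_einf (f : (T -> \bar R)^nat) :
  (forall n, measurable_fun D (f n)) -> measurable_fun D (fun x => limn_einf (f^~ x)).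
Proof.
move=> mf; rewrite (_ : (fun x => _) = fun x => (- limn_esup ((fun n => \- f n)^~ x))%E).
  by apply: measurableT_comp => //; apply: measurable_fun_limn_esup => n;
    exact: measurableT_comp.
apply/funext => x; rewrite -limn_einfN; congr limn_einf.
by apply/funext => n /=; rewrite oppeK.
Qed.

Hypothesis muD : (mu D < +oo)%E.

(** Integrates a |f| <= a^2 + f^2. With a of the size of the L^2 norm, this bounds the L^1 norm by a
    multiple of the L^2 norm. *)
Lemma integral_norm_le_sqr (f : T -> R) (a : R) : measurable_fun D f -> 0 < a ->
  (\int[mu]_(x in D) `|f x|%:E <=
   a%:E * mu D + (a^-1)%:E * \int[mu]_(x in D) (f x ^+ 2)%:E)%E.
Proof.
move=> mf a0; rewrite -integral_cst// -ge0_integralZl//; last 3 first.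
- by apply/measurable_EFinP; exact: measurable_funX.
- by move=> x _; rewrite lee_fin sqr_ge0.
- by rewrite lee_fin invr_ge0 ltW.
rewrite -ge0_integralD//; last 3 first.
- by move=> x _; rewrite /= lee_fin ltW.
- by move=> x _; rewrite mule_ge0// lee_fin ?sqr_ge0// invr_ge0 ltW.
- by apply: measurable_funeM; apply/measurable_EFinP; exact: measurable_funX.
apply: ge0_le_integral => //.
- by apply/measurable_EFinP; exact: measurableT_comp.
- apply: emeasurable_funD => //.
  by apply: measurable_funeM; apply/measurable_EFinP; exact: measurable_funX.
move=> x _ /=; rewrite -EFinM -EFinD lee_fin -[X in _ + _ * X]real_normK ?num_real//.
rewrite -(ler_pM2l a0) mulrDr mulrA divff ?gt_eqF// mul1r.
by have := sqr_ge0 (a - `|f x|); have := sqr_ge0 a; have := sqr_ge0 `|f x|; nra.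
Qed.

(** The Riesz-Fischer argument: a rapidly Cauchy subsequence has increments summable in L^1, hence
    converges almost everywhere, and Fatou's lemma transfers the Cauchy estimate to the limit. *)
Lemma L2_complete (F : nat -> T -> R) : (forall n, measurable_fun D (F n)) ->
  (forall eps : R, (0 < eps)%R -> exists N, forall k l, (N <= k)%N -> (N <= l)%N ->
    \int[mu]_(x in D) ((F k x - F l x) ^+ 2)%:E <= eps%:E)%E ->
  exists f : T -> R, measurable_fun D f /\
    (forall eps : R, (0 < eps)%R -> exists N, forall k, (N <= k)%N ->
    \int[mu]_(x in D) ((f x - F k x) ^+ 2)%:E <= eps%:E)%E.
Proof.
move=> mF cF; pose a j : R := (2 ^ (j + 1))%:R^-1.
have a0 j : 0 < a j by rewrite invr_gt0 ltr0n expn_gt0.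
have /choice[N NP] : forall j, exists N, (forall k l, (N <= k)%N -> (N <= l)%N ->
    \int[mu]_(x in D) ((F k x - F l x) ^+ 2)%:E <= (a j ^+ 2)%:E)%E.
  by move=> j; apply: cF; rewrite exprn_gt0.
(* Cumulative sums make the subsequence increasing, with both [N j] and j below [M j]. *)
pose M j := (\sum_(i < j.+1) (N i).+1)%N.
have MS j : M j.+1 = (M j + (N j.+1).+1)%N by rewrite /M big_ord_recr.
have NM j : (N j <= M j)%N.
  by rewrite /M big_ord_recr/= (leq_trans (leqnSn _))// leq_addl.
have jM j : (j <= M j)%N.
  by elim: j => // j IH; rewrite MS addnS ltnS (leq_trans IH)// leq_addr.
pose phi (j : nat) (x : T) : R := `|F (M j.+1) x - F (M j) x|.
have phi0 j x : (0 <= (phi j x)%:E)%E by rewrite lee_fin /phi.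
have mphi j : measurable_fun D (phi j).
  by apply: measurableT_comp => //; exact: measurable_funB.
pose c := fine (mu D); have cE : mu D = c%:E by rewrite fineK// ge0_fin_numE.
have c0 : 0 <= c by exact: fine_ge0.
(* Taking the parameter [a j] against a squared error [a j ^+ 2] gives [a j] times (c + 1), a
   geometric bound. *)
have iphi j : (\int[mu]_(x in D) (phi j x)%:E <= ((c + 1) / (2 ^ (j + 1))%:R)%:E)%E.
  apply: (le_trans (integral_norm_le_sqr _ (a0 j))); first exact: measurable_funB.
  rewrite cE -EFinM mulrDl mul1r EFinD mulrC leeD//.
  rewrite lee_pdivrMl// -EFinM -/(a j) -expr2; apply: NP.
    by rewrite (leq_trans (NM j))// MS leq_addr.
  exact: NM.
have iS : (\int[mu]_(x in D) (\sum_(0 <= j <oo) (phi j x)%:E) < +oo)%E.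
  rewrite integral_nneseries//; last by move=> n; exact/measurable_EFinP.
  apply: (@le_lt_trans _ _ (c + 1)%:E); last exact: ltry.
  have := @cvg_geometric_eseries_half R (c + 1) 0%N; rewrite expr0 divr1 => /cvg_lim <-//.
  by apply: lee_nneseries => // j _ _; rewrite ?integral_ge0.
have mS : measurable_fun D (fun x => \sum_(0 <= j <oo) (phi j x)%:E)%E.
  apply: ge0_emeasurable_sum => [k x _ _|k _]; first exact: phi0.
  exact/measurable_EFinP.
have S0 x : (0 <= \sum_(0 <= j <oo) (phi j x)%:E)%E.
  by apply: nneseries_ge0.
have aeS : {ae mu, forall x, D x -> (\sum_(0 <= j <oo) (phi j x)%:E)%E \is a fin_num}.
  apply: integrable_ae => //; apply/integrableP; split => //.
  by under eq_integral do rewrite gee0_abs//.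
have aeC : {ae mu, forall x, D x -> cvgn (fun j => F (M j) x)}.
  apply: filterS aeS => x /[apply]; rewrite ge0_fin_numE// => /cvgn_telescope.
  by [].
(* The upper limit is measurable without any convergence assumption, and it is the limit almost
   everywhere. *)
pose f x := fine (limn_esup (fun j => (F (M j) x)%:E)).
have mf : measurable_fun D f.
  apply: measurableT_comp => //; apply: (measurable_fun_limn_esup (f := fun j x => (F (M j) x)%:E)).
  by move=> n; exact/measurable_EFinP.
exists f; split => // eps eps0; have [n nP] := cF _ eps0; exists n => k nk.
(* The shift by n keeps every index [M (j + n)] at least n, so that the Cauchy estimate applies to
   all j. *)
pose G j x : \bar R := ((F (M (j + n)%N) x - F k x) ^+ 2)%:E.
have mG j : measurable_fun D (G j).
  by apply/measurable_EFinP; apply: measurable_funX; exact: measurable_funB.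
have G0 j x : D x -> (0 <= G j x)%E by rewrite lee_fin sqr_ge0.
apply: (@le_trans _ _ (limn_einf (fun j => \int[mu]_(x in D) G j x))%E).
  apply: le_trans (fatou mu mD mG G0).
  rewrite le_eqVlt; apply/orP; left; apply/eqP; apply: ae_eq_integral => //.
  - by apply/measurable_EFinP; apply: measurable_funX; exact: measurable_funB.
  - exact: measurable_fun_limn_einf.
  apply: filterS aeC => x /[apply] /cvg_ex[/= l cl].
  have fl : f x = l.
    rewrite /f; have /cvg_limn_einf_sup[_ ->//] : (F (M j) x)%:E @[j --> \oo] --> l%:E.
    exact: cvg_EFin_nat.
  have /cvg_limn_einf_sup[-> _] : G j x @[j --> \oo] --> ((l - F k x) ^+ 2)%:E.
    apply: cvg_EFin_nat; under eq_fun do rewrite expr2; rewrite expr2.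
    have cl' : F (M (j + n)%N) x - F k x @[j --> \oo] --> l - F k x.
      by apply: cvgB; [rewrite (cvg_shiftn n (fun j => F (M j) x));
        exact: cl|exact: cvg_cst].
    exact: cvgM.
  by rewrite fl.
apply: limn_einf_le_cst => j; apply: nP => //.
by rewrite (leq_trans _ (jM _))// leq_addl.
Qed.

End L2.

(** * Weighted L^2 norms *)

Section weighted_norm.
Context {R : realType}.
Implicit Types (F G H : R -> R[i]) (U W V : R -> R) (z u v : R[i]).
Local Notation mu := (@lebesgue_measure R).
Local Notation D := (`[0%R, 1%R[%classic : set R).

Lemma sqmodD_le u v : sqmod (u + v) <= 2 * sqmod u + 2 * sqmod v.
Proof.
rewrite /sqmod !cReImE.
have := sqr_ge0 (complex.Re u - complex.Re v).
by have := sqr_ge0 (complex.Im u - complex.Im v); nra.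
Qed.

(** The cross term 2 |v| |u - v| is at most e |v|^2 + |u - v|^2 / e. The factor 1 + e close to 1 is
    what allows energies to be compared in the limit. *)
Lemma sqmodB_le (e : R) u v : 0 < e ->
  sqmod u <= (1 + e) * sqmod v + (1 + e^-1) * sqmod (u - v).
Proof.
move=> e0; have : sqmod u = sqmod (v + (u - v)) by rewrite addrC subrK.
move: (u - v) => w ->; rewrite /sqmod !cReImE.
have H p q : 0 <= e * p ^+ 2 - 2 * p * q + e^-1 * q ^+ 2.
  rewrite (_ : _ + _ = e^-1 * (e * p - q) ^+ 2); last by field; rewrite gt_eqF.
  by rewrite mulr_ge0 ?sqr_ge0// invr_ge0 ltW.
have := H (complex.Re v) (complex.Re w).
have := H (complex.Im v) (complex.Im w).
by lra.
Qed.

Lemma sqmodN u : sqmod (- u) = sqmod u.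
Proof. by rewrite /sqmod !cReImE !sqrrN. Qed.

Lemma sqmodBC u v : sqmod (u - v) = sqmod (v - u).
Proof. by rewrite -sqmodN opprB. Qed.

Definition wnorm W F : \bar R := (\int[mu]_(x in D) (sqmod (F x) * W x)%:E)%E.

Lemma wnorm_ge0 W F : (forall x, D x -> 0 <= W x) -> (0 <= wnorm W F)%E.
Proof.
by move=> W0; apply: integral_ge0 => x /W0 ?; rewrite lee_fin mulr_ge0// sqmod_ge0.
Qed.

Lemma measurable_sqmodM W F : measurable_fun D W -> cmeasurable D F ->
  measurable_fun D (fun x => (sqmod (F x) * W x)%:E).
Proof.
move=> mW mF; apply/measurable_EFinP; apply: measurable_funM => //.
exact: measurable_sqmod.
Qed.

Lemma wnorm_le_comb U W V F G H (a b : R) :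
  measurable_fun D U -> measurable_fun D W -> measurable_fun D V ->
  cmeasurable D F -> cmeasurable D G -> cmeasurable D H ->
  (forall x, D x -> 0 <= U x) -> (forall x, D x -> 0 <= W x) ->
  (forall x, D x -> 0 <= V x) -> 0 <= a -> 0 <= b ->
  (forall x, D x -> sqmod (F x) * U x <= a * (sqmod (G x) * W x) + b * (sqmod (H x)
    * V x)) ->
  (wnorm U F <= a%:E * wnorm W G + b%:E * wnorm V H)%E.
Proof.
move=> mU mW mV mF mG mH U0 W0 V0 a0 b0 le.
have mGW := measurable_sqmodM mW mG; have mHV := measurable_sqmodM mV mH.
have GW0 x : D x -> (0 <= (sqmod (G x) * W x)%:E)%E.
  by move=> /W0 ?; rewrite lee_fin mulr_ge0// sqmod_ge0.
have HV0 x : D x -> (0 <= (sqmod (H x) * V x)%:E)%E.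
  by move=> /V0 ?; rewrite lee_fin mulr_ge0// sqmod_ge0.
rewrite /wnorm -!ge0_integralZl//.
rewrite -ge0_integralD//; last 4 first.
- by move=> x Dx; rewrite mule_ge0 ?GW0.
- exact: measurable_funeM.
- by move=> x Dx; rewrite mule_ge0 ?HV0.
- exact: measurable_funeM.
apply: ge0_le_integral => //.
- by move=> x /U0 ?; rewrite lee_fin mulr_ge0// sqmod_ge0.
- exact: measurable_sqmodM.
- by apply: emeasurable_funD; exact: measurable_funeM.
Qed.

Lemma wnorm_truncation W F (c : \bar R) : measurable_fun D W -> cmeasurable D F ->
  (forall x, D x -> 0 <= W x) ->
  (forall n : nat, wnorm (fun x => Num.min (W x) n%:R) F <= c)%E -> (wnorm W F <= c)%E.
Proof.
move=> mW mF W0 wc.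
pose g (n : nat) x := (sqmod (F x) * Num.min (W x) n%:R)%:E.
have cg : (fun n => \int[mu]_(x in D) g n x)%E @ \oo --> wnorm W F.
  have -> : wnorm W F = (\int[mu]_(x in D) limn (g^~ x))%E.
    apply: eq_integral => x _; apply/esym/cvg_lim => //.
    apply: cvg_near_cst.
    exists (Num.bound `|W x|) => // n /= nW; rewrite /g min_l//.
    rewrite (le_trans (ler_norm _))// ltW// (lt_le_trans (archi_boundP _))//.
    by rewrite ler_nat.
  apply: cvg_monotone_convergence => //.
  - move=> n; apply: measurable_sqmodM => //.
    exact: measurable_minr.
  - by move=> n x /W0 ?; rewrite lee_fin mulr_ge0 ?sqmod_ge0// le_min ler0n andbT.
  - move=> x _ m n mn; rewrite lee_fin ler_wpM2l ?sqmod_ge0//.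
    by rewrite le_min ge_min lexx/= ge_min ler_nat mn orbT.
rewrite -(cvg_lim _ cg)//; apply: lime_le; first by apply/cvg_ex; exists (wnorm W F).
exact: nearW.
Qed.

(* The weight is truncated so that convergence in L^2(m) controls the
   remainder; monotone convergence then removes the truncation. *)
Lemma wnorm_lower_semicontinuous W F (G : nat -> R -> R[i]) (e : R) :
  measurable_fun D W -> (forall x, D x -> 0 <= W x) ->
  cmeasurable D F -> (forall n, cmeasurable D (G n)) -> 
  (forall eta : R, 0 < eta -> exists n, (wnorm W (G n) <= e%:E)%E /\
    (wnorm (fun=> 1%R) (F \- G n)%R <= eta%:E)%E) ->
  (wnorm W F <= (2 * e)%:E)%E.
Proof.
move=> mW W0 mF mG GF; apply: wnorm_truncation => // n.
apply/lee_addgt0Pr => eta eta0.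
(* The truncated weight is at most n + 1, so the remainder costs 2 (n + 1) times its L^2(m) norm
   squared, that is [eta]. The successor avoids dividing by zero. *)
have eta1 : 0 < eta / (2 * n.+1%:R) by rewrite divr_gt0// mulr_gt0.
have [k [Ge FGk]] := GF _ eta1.
apply: (@le_trans _ _ (2%R%:E * wnorm W (G k)
  + (2 * n.+1%:R)%R%:E * wnorm (fun=> 1%R) (F \- G k)%R)%E).
  apply: wnorm_le_comb => //.
  - exact: measurable_minr.
  - exact: cmeasurableB.
  - by move=> x /W0 ?; rewrite le_min ler0n andbT.
  move=> x /W0 W0x; rewrite mulr1.
  set m := Num.min _ _.
  have m0 : 0 <= m by rewrite le_min ler0n andbT.
  have mW' : m <= W x by rewrite ge_min lexx.
  have mn : m <= n.+1%:R by rewrite ge_min ler_nat leqnSn orbT.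
    apply: (@le_trans _ _ ((2 * sqmod (G k x) + 2 * sqmod (F x - G k x)) * m)).
    rewrite ler_wpM2r//; apply: le_trans (sqmodD_le _ _).
    by rewrite addrC subrK.
  rewrite mulrDl lerD//; first by rewrite -mulrA ler_wpM2l// ler_wpM2l ?sqmod_ge0.
  by rewrite -mulrA [leRHS]mulrAC -mulrA ler_wpM2l// ler_wpM2l ?sqmod_ge0.
apply: leeD; first by rewrite EFinM lee_wpmul2l.
by rewrite -lee_pdivlMl ?mulr_gt0// -EFinM mulrC.
Qed.

End weighted_norm.

(** * Square-summable and finitely supported sequences *)

Section sequences.
Context {R : realType}.
Implicit Types (g u v : nat -> R[i]).
Local Notation D := (`[0%R, 1%R[%classic : set R).

Lemma ge0_cvge0P (x : (\bar R)^nat) : (forall n, 0 <= x n)%E ->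
  (x @ \oo --> 0%E) <->
  (forall e : R, 0 < e -> exists N, forall k, (N <= k)%N -> (x k <= e%:E)%E).
Proof.
move=> x0; split => [/fine_cvgP[xfin /cvgrPdist_le xe] e e0|xe].
  have [N _ NP] := filterI xfin (xe _ e0); exists N => k Nk; have [fk] := NP _ Nk.
  by rewrite /= sub0r normrN -{2}(fineK fk) lee_fin; apply: le_trans; exact: ler_norm.
have xfin N k (e : R) : (x k <= e%:E)%E -> x k \is a fin_num.
  by move=> xke; rewrite ge0_fin_numE// (le_lt_trans xke)// ltry.
apply/fine_cvgP; split.
  by have [N NP] := xe _ ltr01; exists N => // k /NP; exact: xfin.
apply/cvgrPdist_le => e e0; have [N NP] := xe _ e0; exists N => // k /NP xk.
rewrite /= sub0r normrN ger0_norm ?fine_ge0//.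
by rewrite -lee_fin fineK//; exact: xfin xk.
Qed.

Lemma l2sqE u : l2sq u = (\sum_(0 <= n <oo) (sqmod (u n))%:E)%E.
Proof. by apply: eq_eseriesr => n _; rewrite cabs_sqr. Qed.

Lemma l2sq_ge0 u : (0 <= l2sq u)%E.
Proof. by apply: nneseries_ge0 => n _ _; rewrite lee_fin sqr_ge0. Qed.

Lemma l2sq_le_comb u v v' (a b : R) : 0 <= a -> 0 <= b ->
  (forall n, sqmod (u n) <= a * sqmod (v n) + b * sqmod (v' n)) ->
  (l2sq u <= a%:E * l2sq v + b%:E * l2sq v')%E.
Proof.
move=> a0 b0 le; rewrite !l2sqE.
have S0 (w : nat -> R[i]) n : true -> (0 <= (sqmod (w n))%:E)%E by rewrite lee_fin sqmod_ge0.
rewrite -(nneseriesZl a 0 (S0 v)) -(nneseriesZl b 0 (S0 v')).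
rewrite -nneseriesD//; last 2 first.
- by move=> n _ _; rewrite -EFinM lee_fin mulr_ge0// sqmod_ge0.
- by move=> n _ _; rewrite -EFinM lee_fin mulr_ge0// sqmod_ge0.
apply: lee_nneseries => [n _ _|n _]; first by rewrite lee_fin sqmod_ge0.
  by rewrite -!EFinM -EFinD lee_fin.
Qed.

Lemma l2sq_le u v : (forall n, sqmod (u n) <= sqmod (v n)) -> (l2sq u <= l2sq v)%E.
Proof.
move=> le; rewrite !l2sqE; apply: lee_nneseries => [n _ _|n _];
  rewrite lee_fin ?sqmod_ge0//.
Qed.

Definition supported_below N u := forall n, (N <= n)%N -> u n = 0.

Lemma l2sq_finite u N : supported_below N u ->
  l2sq u = (\sum_(n < N) sqmod (u n))%:E.
Proof.
move=> uN; rewrite l2sqE (nneseries_split _ N)//; last first.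
  by move=> n _; rewrite lee_fin sqmod_ge0.
rewrite add0n eseries0 ?adde0 ?sumEFin ?big_mkord// => n Nn _.
by rewrite uN// /sqmod/= expr0n addr0.
Qed.

Definition trunc N u : nat -> R[i] := fun n => if (n < N)%N then u n else 0.

Lemma trunc_supported N u : supported_below N (trunc N u).
Proof. by move=> n Nn; rewrite /trunc ltnNge Nn. Qed.

Lemma l2sq_sub_trunc_cvg g : l2 R g -> forall e : R, 0 < e ->
  exists N, forall k, (N <= k)%N -> (l2sq (seqB g (trunc k g)) <= e%:E)%E.
Proof.
move=> gl2 e e0; rewrite /l2/= l2sqE in gl2.
have g0 n : true -> (0 <= (sqmod (g n))%:E)%E by rewrite lee_fin sqmod_ge0.
have := nneseries_tail_cvg gl2 (fun k _ => g0 k isT).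
move=> /fine_cvgP[fN /cvgrPdist_le /(_ _ e0) h].
have [N _ NP] := filterI fN h; exists N => k Nk.
have [tfin te] := NP _ Nk.
rewrite l2sqE (nneseries_split 0 k)//; last first.
  by move=> n _; rewrite lee_fin sqmod_ge0.
rewrite add0n big_nat_cond big1 ?add0e; last first.
  by move=> n /andP[/andP[_ nk] _]; rewrite /seqB /trunc nk subrr /sqmod/= expr0n addr0.
rewrite (_ : (\sum_(k <= n <oo) _)%E = (\sum_(k <= n <oo) (sqmod (g n))%:E)%E).
  rewrite -(fineK tfin) lee_fin (le_trans (ler_norm _))//.
  by rewrite -normrN -[X in `|X|]add0r.
rewrite !(eseries_cond _ xpredT); apply: eq_eseriesr => n /= kn.
by rewrite /seqB /trunc ltnNge kn subr0.
Qed.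

Lemma finite_seqsP u : finite_seqs R u <-> exists N, supported_below N u.
Proof.
split => [|[N uN]]; last first.
  apply: (sub_finite_set _ (finite_II N)) => n /= un0.
  by rewrite ltnNge; apply: contra un0 => /uN ->.
move=> /finite_fsetP[A AE].
exists (\max_(i <- finmap.enum_fset A) i).+1 => n An.
apply/eqP; apply: contraTT An => un0; rewrite -ltnNge ltnS.
have nA : n \in finmap.enum_fset A.
  have : [set n | u n != 0] n by [].
  by rewrite AE.
exact: (@leq_bigmax_seq _ _ xpredT id).
Qed.

Lemma trig_widen u N M : supported_below N u -> (N <= M)%N ->
  trig u M = trig u N.
Proof.
move=> uN NM; apply/funext => x; rewrite /trig.
rewrite -!(big_mkord xpredT (fun n => u n * circ x ^+ n)).
rewrite (@big_cat_nat _ _ _ N)//= [X in _ + X](_ : _ = 0) ?addr0//.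
rewrite big_nat_cond big1// => n /andP[/andP[Nn _] _].
by rewrite uN// mul0r.
Qed.

Lemma trig_trunc u N : trig (trunc N u) N = trig u N.
Proof.
by apply/funext => x; apply: eq_bigr => n _; rewrite /trunc ltn_ord.
Qed.

(** Some bound, not the least one: by [finite_trigE] the polynomial does not depend on the
    choice. *)
Definition support_bound u := xget 0%N [set N | supported_below N u].

Definition finite_trig u := trig u (support_bound u).

Lemma finite_trigE u N : supported_below N u -> finite_trig u = trig u N.
Proof.
move=> uN; have /xgetPex /= : exists N, supported_below N u by exists N.
move=> /(_ 0%N); rewrite -/(support_bound u) => ubN;
  have [le|/ltnW le] := leqP (support_bound u) N.
  by rewrite /finite_trig (trig_widen ubN le).
by rewrite /finite_trig (trig_widen uN le).
Qed.

Lemma cmeasurable_finite_trig u : cmeasurable D (finite_trig u).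
Proof. exact: cmeasurable_trig. Qed.

Lemma trig_comb u v (a b : R[i]) N (x : R) :
  trig (fun n => a * u n + b * v n) N x = a * trig u N x + b * trig v N x.
Proof.
rewrite /trig !mulr_sumr -big_split/=; apply: eq_bigr => n _; ring.
Qed.

Lemma supported_below_widen N M u : (N <= M)%N -> supported_below N u ->
  supported_below M u.
Proof. by move=> NM uN n Mn; rewrite uN// (leq_trans NM). Qed.

Lemma finite_seqs_common_support u v : finite_seqs R u -> finite_seqs R v ->
  exists N, supported_below N u /\ supported_below N v.
Proof.
move=> /finite_seqsP[N uN] /finite_seqsP[M vM]; exists (maxn N M); split.
  exact: supported_below_widen (leq_maxl _ _) uN.
exact: supported_below_widen (leq_maxr _ _) vM.
Qed.

Lemma supported_below_comb u v (a b : R[i]) N : supported_below N u ->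
  supported_below N v -> supported_below N (fun n => a * u n + b * v n).
Proof. by move=> uN vN n Nn; rewrite uN// vN// !mulr0 addr0. Qed.

Lemma seqB_comb u v : seqB u v = (fun n => 1 * u n + (-1) * v n).
Proof. by apply/funext => n; rewrite mul1r mulN1r. Qed.

Lemma finite_seqs_comb u v (a b : R[i]) : finite_seqs R u -> finite_seqs R v ->
  finite_seqs R (fun n => a * u n + b * v n).
Proof.
move=> fu fv; have [N [uN vN]] := finite_seqs_common_support fu fv.
by apply/finite_seqsP; exists N; exact: supported_below_comb.
Qed.

Lemma finite_trig_comb u v (a b : R[i]) (x : R) : finite_seqs R u -> finite_seqs R v ->
  finite_trig (fun n => a * u n + b * v n) x = a * finite_trig u x + b * finite_trig v x.
Proof.
move=> fu fv; have [N [uN vN]] := finite_seqs_common_support fu fv.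
rewrite (finite_trigE uN) (finite_trigE vN) (finite_trigE (N := N)) ?trig_comb//.
exact: supported_below_comb.
Qed.

Lemma finite_seqsB u v : finite_seqs R u -> finite_seqs R v -> finite_seqs R (seqB u v).
Proof. by rewrite seqB_comb; exact: finite_seqs_comb. Qed.

Lemma finite_trigB u v (x : R) : finite_seqs R u -> finite_seqs R v ->
  finite_trig (seqB u v) x = finite_trig u x - finite_trig v x.
Proof. by move=> ? ?; rewrite seqB_comb finite_trig_comb// mul1r mulN1r. Qed.

Lemma finite_trunc N u : finite_seqs R (trunc N u).
Proof. by apply/finite_seqsP; exists N; exact: trunc_supported. Qed.

Lemma parseval_l2sq u : finite_seqs R u -> wnorm (fun=> 1%R) (finite_trig u) = l2sq u.
Proof.
move=> /finite_seqsP[N uN]; rewrite (finite_trigE uN) (l2sq_finite uN) -parseval.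
by apply: eq_integral => x _; rewrite mulr1.
Qed.

Lemma finite_trig_trunc N u : finite_trig (trunc N u) = trig u N.
Proof. by rewrite (finite_trigE (@trunc_supported N u)) trig_trunc. Qed.

Lemma toeplitz_form_wnorm w u : circle_integrable w -> finite_seqs R u ->
  toeplitz_form w u = (complex.Re (toeplitz_form w u))%:C /\
  (complex.Re (toeplitz_form w u))%:E = wnorm (fun x => w (circ x)) (finite_trig u).
Proof.
move=> iw /finite_seqsP[N uN]; split; first by have [->] := toeplitz_formE iw uN.
by rewrite (Re_toeplitz_form iw uN) (finite_trigE uN).
Qed.

End sequences.

(** * The sum A g in L^2 of the circle *)

Section analytic_sum.
Context {R : realType}.
Implicit Types (g u : nat -> R[i]) (f : R[i] -> R[i]).
Local Notation mu := (@lebesgue_measure R).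
Local Notation D := (`[0%R, 1%R[%classic : set R).

Lemma is_L2_sumE g f : is_L2_sum g f <->
  cmeasurable D (fun x => f (circ x)) /\
  (wnorm (fun=> 1%R) (fun x => f (circ x) - trig g N x)%R @[N --> \oo] --> 0)%E.
Proof.
rewrite /is_L2_sum /circle_measurable /circle_integral circle_paramE.
have -> : (fun N => \int[mu]_(x in `[0%R, 1%R[%classic)
    (cabs (f (circ x) - \sum_(n < N) g n * circ x ^+ n) ^+ 2)%:E)%E =
  (fun N => wnorm (fun=> 1%R) (fun x => f (circ x) - trig g N x)%R).
  by apply/funext => N; apply: eq_integral => x _; rewrite cabs_sqr mulr1.
by split => [[? ? ?]|[[? ?] ?]].
Qed.

(** The difference has for coefficients a block of g beyond N, up to sign, so Parseval bounds it by
    the tail of g. *)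
Lemma wnorm1_trigB g : l2 R g -> forall e : R, 0 < e -> exists N, forall k l,
  (N <= k)%N -> (N <= l)%N ->
  (wnorm (fun=> 1%R) (fun x => trig g k x - trig g l x)%R <= e%:E)%E.
Proof.
move=> gl2 e e0; have [N NP] := l2sq_sub_trunc_cvg gl2 e0; exists N => k l Nk Nl.
apply: le_trans (NP N (leqnn _)).
rewrite (_ : (fun x => _) = finite_trig (seqB (trunc k g) (trunc l g))); last first.
  apply/funext => x; rewrite finite_trigB ?finite_trig_trunc//; exact: finite_trunc.
rewrite parseval_l2sq; last by apply: finite_seqsB; exact: finite_trunc.
apply: l2sq_le => n; rewrite /seqB /trunc.
have [nN|Nn] := ltnP n N.
  by rewrite (leq_trans nN Nk) (leq_trans nN Nl) !subrr.
by case: ifP; case: ifP => _ _; rewrite ?subrr ?subr0 ?sub0r ?sqmodN//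
  /sqmod/= expr0n addr0 addr_ge0 ?sqr_ge0.
Qed.

(** Completeness is applied to the real and the imaginary parts of the partial sums separately; the
    two squared errors add up to the squared modulus. *)
Lemma is_L2_sum_exists g : l2 R g -> exists f, is_L2_sum g f.
Proof.
move=> gl2; have mD : measurable D by [].
have muD : (mu D < +oo)%E by rewrite lebesgue_measure_co01 ltry.
have sqle (x : R) k l (P : R[i] -> R) : (forall z, P z ^+ 2 <= sqmod z) -> 
   (forall z z', P (z - z') = P z - P z') ->
   (P (trig g k x) - P (trig g l x)) ^+ 2 <= sqmod (trig g k x - trig g l x) * 1.
  by move=> Pz PB; rewrite mulr1 -PB.
have ReP (z : R[i]) : complex.Re z ^+ 2 <= sqmod z by rewrite /sqmod lerDl sqr_ge0.
have ImP (z : R[i]) : complex.Im z ^+ 2 <= sqmod z by rewrite /sqmod lerDr sqr_ge0.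
have mtrig k : cmeasurable D (trig g k) by exact: cmeasurable_trig.
have cauchy (P : R[i] -> R) : (forall z, P z ^+ 2 <= sqmod z) ->
   (forall z z', P (z - z') = P z - P z') ->
     (forall k, measurable_fun D (P \o trig g k)) ->
   exists h : R -> R, measurable_fun D h /\
    (forall eps : R, (0 < eps)%R -> exists N, forall k, (N <= k)%N ->
    \int[mu]_(x in D) ((h x - P (trig g k x)) ^+ 2)%:E <= eps%:E)%E.
  move=> Pz PB mP; apply: (@L2_complete _ _ R mu D mD muD (fun n x => P (trig g n x))) => //.
  move=> e e0; have [N NP] := wnorm1_trigB gl2 e0; exists N => k l Nk Nl.
  apply: le_trans (NP k l Nk Nl); apply: ge0_le_integral => //.
  - by move=> x _; rewrite lee_fin sqr_ge0.
  - apply/measurable_EFinP; apply: measurable_funX.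
    by apply: measurable_funB; exact: mP.
  - by apply: measurable_sqmodM => //; apply: cmeasurableB; exact: cmeasurable_trig.
  - by move=> x _; rewrite lee_fin; exact: sqle.
have [fr [mfr frP]] := cauchy (@complex.Re R) ReP (fun z z' => etrans (cReD _ _)
  (congr1 _ (cReN _))) (fun k => (mtrig k).1).
have [fi [mfi fiP]] := cauchy (@complex.Im R) ImP (fun z z' => etrans (cImD _ _)
  (congr1 _ (cImN _))) (fun k => (mtrig k).2).
(* circ is injective on [0, 1[, so any function of x there is a function of circ x *)
pose t z : R := xget 0 [set x | (x \in `[0%R, 1%R[) /\ circ x = z].
have tE x : D x -> t (circ x) = x.
  move=> Dx; have [] : [set y | (y \in `[0%R, 1%R[) /\ circ y = circ x] (t (circ x)).
    by apply: xgetPex; exists x; split.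
  by move=> tD; apply: circ_inj.
exists (fun z => fr (t z) +i* fi (t z)); apply/is_L2_sumE; split.
  by split; [apply: eq_measurable_fun mfr|apply: eq_measurable_fun mfi] => x;
    rewrite inE => Dx /=; rewrite tE.
apply/ge0_cvge0P => [n|e e0]; first by apply: wnorm_ge0 => *; exact: ler01.
have e2 : 0 < e / 2 by rewrite divr_gt0.
have [N1 N1P] := frP _ e2; have [N2 N2P] := fiP _ e2.
exists (maxn N1 N2) => k; rewrite geq_max => /andP[/N1P k1 /N2P k2].
rewrite [e]splitr EFinD; apply: le_trans (leeD k1 k2).
have [mtr mti] := mtrig k.
rewrite -ge0_integralD//; first last.
- by apply/measurable_EFinP; apply: measurable_funX; exact: measurable_funB.
- by move=> x _; rewrite lee_fin sqr_ge0.
- by apply/measurable_EFinP; apply: measurable_funX; exact: measurable_funB.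
- by move=> x _; rewrite lee_fin sqr_ge0.
rewrite le_eqVlt; apply/orP; left; apply/eqP; apply: eq_integral => x; rewrite inE => Dx.
by rewrite tE// mulr1 /sqmod !cReImE -EFinD.
Qed.

Lemma calA_is_L2_sum g : l2 R g -> is_L2_sum g (calA g).
Proof. by move=> /is_L2_sum_exists; exact: xgetPex. Qed.

Lemma calA_finite_trig g u : l2 R g -> finite_seqs R u ->
  (wnorm (fun=> 1%R) (fun x => calA g (circ x)
    - finite_trig u x)%R <= 2%:E * l2sq (seqB g u))%E.
Proof.
move=> gl2 fu; have /is_L2_sumE[mf] := calA_is_L2_sum gl2.
move=> /(ge0_cvge0P _).1 cf.
apply/lee_addgt0Pr => e e0.
have e2 : 0 < e / 2 by rewrite divr_gt0.
have [N1 N1P] := cf (fun n => wnorm_ge0 _ (fun _ _ => ler01)) _ e2.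
move: (fu) => /finite_seqsP[N2 uN].
(* Beyond the support of u, both the truncation of g and u vanish, so their difference is at most g
   - u in each coordinate. *)
pose N := maxn N1 N2.
apply: (@le_trans _ _ (2%R%:E * wnorm (fun=> 1%R) (fun x => finite_trig (trunc N g)
  x - finite_trig u x)%R
   + 2%R%:E * wnorm (fun=> 1%R) (fun x => calA g (circ x) - trig g N x)%R)%E).
  apply: wnorm_le_comb => //.
  - by apply: cmeasurableB => //; exact: cmeasurable_finite_trig.
  - by apply: cmeasurableB => //; exact: cmeasurable_finite_trig.
  - by apply: cmeasurableB => //; exact: cmeasurable_trig.
  move=> x _; rewrite !mulr1 finite_trig_trunc.
  apply: le_trans (sqmodD_le _ _).
  rewrite [leRHS](_ : _ = sqmod (calA g (circ x) - finite_trig u x))//.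
  by congr sqmod; ring.
apply: leeD.
  rewrite lee_wpmul2l//.
  rewrite (_ : (fun x => _) = finite_trig (seqB (trunc N g) u)); last first.
    by apply/funext => x; rewrite finite_trigB//; exact: finite_trunc.
  rewrite parseval_l2sq; last by apply: finite_seqsB => //; exact: finite_trunc.
  apply: l2sq_le => n; rewrite /seqB /trunc; case: ltnP => // Nn.
  rewrite uN ?subr0; first by rewrite /sqmod/= expr0n addr0 addr_ge0 ?sqr_ge0.
  by rewrite (leq_trans _ Nn)// leq_maxr.
by rewrite -lee_pdivlMl// -EFinM mulrC; apply: N1P; exact: leq_maxl.
Qed.

End analytic_sum.

(** * Cauchy sequences of near-minimizers *)

Section minimizing_sequence.
Context {R : realType}.
Implicit Types (g u v : nat -> R[i]).

Definition midpoint u v : nat -> R[i] := fun n => 2^-1 * u n + 2^-1 * v n.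

Lemma sqmod_midpoint (a b c : R[i]) :
  sqmod (2^-1 * a + 2^-1 * b - c) <= 2^-1 * sqmod (a - c) + 2^-1 * sqmod (b - c).
Proof.
have h : 2^-1 = (2^-1 : R)%:C :> R[i] by rewrite fmorphV/= rmorph_nat.
rewrite h /sqmod !cReImE/= !mul0r !subr0 !addr0.
have := sqr_ge0 (complex.Re a - complex.Re b).
by have := sqr_ge0 (complex.Im a - complex.Im b); nra.
Qed.

Lemma l2sq_midpoint g u v (e : R) : (l2sq (seqB u g) <= e%:E)%E ->
  (l2sq (seqB v g) <= e%:E)%E -> (l2sq (seqB (midpoint u v) g) <= e%:E)%E.
Proof.
move=> ue ve.
apply: (@le_trans _ _ ((2^-1)%R%:E * l2sq (seqB u g) + (2^-1)%R%:E * l2sq (seqB v g))%E).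
  by apply: l2sq_le_comb => // n; exact: sqmod_midpoint.
apply: (@le_trans _ _ ((2^-1)%R%:E * e%:E + (2^-1)%R%:E * e%:E)%E).
  by apply: leeD; rewrite lee_wpmul2l// lee_fin.
by rewrite -!EFinM -EFinD lee_fin; lra.
Qed.

Lemma finite_midpoint u v : finite_seqs R u -> finite_seqs R v ->
  finite_seqs R (midpoint u v).
Proof. exact: finite_seqs_comb. Qed.

(* Near-minimizers of E over the midpoint-convex sets {u | |u - g|^2 <= 1/(k+1)},
   which decrease in k, form a Cauchy sequence by the parallelogram law. *)
Lemma minimizing_sequence (E : (nat -> R[i]) -> R) g (B : R) :
  (forall u, finite_seqs R u -> 0 <= E u) ->
  (forall u v, finite_seqs R u -> finite_seqs R v ->
     E (seqB u v) = 2 * E u + 2 * E v - 4 * E (midpoint u v)) ->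
  (forall e : R, 0 < e -> exists u,
     [/\ finite_seqs R u, (l2sq (seqB u g) <= e%:E)%E & E u <= B]) ->
  exists v : nat -> nat -> R[i],
    [/\ forall k, finite_seqs R (v k),
        forall k, (l2sq (seqB (v k) g) <= (k.+1%:R^-1)%:E)%E &
        forall e : R, 0 < e -> exists N, forall k l, (N <= k)%N -> (N <= l)%N ->
          E (seqB (v k) (v l)) <= e].
Proof.
move=> E0 Epar uB.
pose C k := [set u | finite_seqs R u /\ (l2sq (seqB u g) <= (k.+1%:R^-1)%:E)%E].
have CS k l u : (k <= l)%N -> C l u -> C k u.
  move=> kl [fu ul]; split => //; apply: le_trans ul _.
  by rewrite lee_fin lef_pV2 ?posrE ?ltr0n// ler_nat ltnS.
have CB k : exists2 u, C k u & E u <= B.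
  have k0 : 0 < (k.+1%:R : R)^-1 by rewrite invr_gt0 ltr0n.
  by have [u [? ? ?]] := uB _ k0; exists u.
have Cinf k : has_inf (E @` C k).
  split; first by have [u Cu _] := CB k; exists (E u), u.
  by exists 0 => _ [u [fu _] <-]; exact: E0.
pose d k := inf (E @` C k).
have dle k u : C k u -> d k <= E u.
  by move=> Cu; apply: ge_inf; [exact: (Cinf k).2|exists u].
have dB k : d k <= B.
  by have [u Cu uB'] := CB k; apply: le_trans uB'; exact: dle.
have /choice[v vP] k : exists u, C k u /\ E u < d k + k.+1%:R^-1.
  have k0 : 0 < (k.+1%:R : R)^-1 by rewrite invr_gt0 ltr0n.
  by have [_ [u Cu <-] lt] := inf_adherent k0 (Cinf k); exists u.
exists v; split=> [k|k|e e0]; [by have [[]] := vP k|by have [[]] := vP k|].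
have supd : has_sup (range d).
  by split; [exists (d 0%N), 0%N|exists B => _ [k _ <-]].
pose S := sup (range d).
have dS k : d k <= S by apply: ub_le_sup; [exact: supd.2|exists k].
(* Two energies of at most S + e/8 and a midpoint energy above S - e/8 give, in the parallelogram
   law, 4 (S + e/8) - 4 (S - e/8) = e. *)
have e8 : 0 < e / 8 by rewrite divr_gt0.
have [_ [N1 _ <-] N1S] := sup_adherent e8 supd.
have [N2 N2e] : exists N2, (N2.+1%:R : R)^-1 <= e / 8.
  exists (Num.bound (e / 8)^-1).
  rewrite -[leRHS]invrK lef_pV2 ?posrE ?invr_gt0 ?ltr0n//.
  have e8V : 0 <= (e / 8)^-1 by rewrite invr_ge0 ltW.
  by rewrite (le_trans (ltW (archi_boundP e8V)))// ler_nat.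
have near_opt k : (maxn N1 N2 <= k)%N -> E (v k) <= S + e / 8 /\ C N1 (v k).
  rewrite geq_max => /andP[k1 k2]; have [Ck lt] := vP k; split; last exact: CS Ck.
  rewrite (le_trans (ltW lt))// lerD// (le_trans _ N2e)//.
  by rewrite lef_pV2 ?posrE ?ltr0n// ler_nat ltnS.
exists (maxn N1 N2) => k l /near_opt[kS Ck] /near_opt[lS Cl].
(* Both points lie in the same set [C N1], hence so does their midpoint, whose energy is therefore
   at least [d N1]. *)
have Cm : C N1 (midpoint (v k) (v l)).
  by split; [exact: finite_midpoint Ck.1 Cl.1|exact: l2sq_midpoint Ck.2 Cl.2].
have := dle _ _ Cm; rewrite -/S in N1S; rewrite Epar ?Ck.1 ?Cl.1//; last 2 first.
- exact: Ck.1.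
- exact: Cl.1.
by lra.
Qed.

End minimizing_sequence.

(** * Partition of the circle into arcs *)

Section cells.
Context {R : realType}.
Implicit Types (N j : nat) (x y t : R).
Local Notation mu := (@lebesgue_measure R).
Local Notation D := (`[0%R, 1%R[%classic : set R).

Definition cell N j : set R := [set x | j%:R / N%:R <= x < j.+1%:R / N%:R].

Lemma cellE N j : cell N j = `[(j%:R / N%:R)%R, (j.+1%:R / N%:R)%R[%classic.
Proof. by apply/seteqP; split => x /=; rewrite in_itv. Qed.

Lemma measurable_cell N j : measurable (cell N j).
Proof. by rewrite cellE. Qed.

Lemma cell_le N j : (j%:R / N%:R : R) <= j.+1%:R / N%:R.
Proof. by rewrite ler_wpM2r ?invr_ge0// ler_nat. Qed.

Lemma cell_sub N j : (j < N)%N -> cell N j `<=` D.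
Proof.
move=> jN x /andP[jx xj]; rewrite /= in_itv/=; apply/andP; split.
  by apply: le_trans jx; rewrite divr_ge0.
apply: lt_le_trans xj _.
by rewrite ler_pdivrMr ?mul1r ?ler_nat// ltr0n (leq_ltn_trans _ jN).
Qed.

Lemma cell_disjoint N i j : (i < j)%N -> cell N i `&` cell N j = set0.
Proof.
move=> ij; apply/seteqP; split => // x [/andP[_ xi] /andP[jx _]].
suff : x < x by rewrite ltxx.
apply: lt_le_trans xi (le_trans _ jx).
by rewrite ler_wpM2r ?invr_ge0// ler_nat.
Qed.

Lemma integral_cells N (phi : R -> \bar R) : (0 < N)%N -> measurable_fun D phi ->
  (forall x, D x -> 0 <= phi x)%E ->
  (\int[mu]_(x in D) phi x = \sum_(j < N) \int[mu]_(x in cell N j) phi x)%E.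
Proof.
move=> N0 mphi phi0.
have itvS k : (k < N)%N -> `[0%R, (k.+1%:R / N%:R)%R[%classic =
    `[0%R, (k%:R / N%:R : R)%R[%classic `|` cell N k.
  move=> kN; rewrite cellE (@itv_bndbnd_setU _ _ _ (BLeft (k%:R / N%:R)))//.
    by rewrite bnd_simp divr_ge0.
  by rewrite bnd_simp cell_le.
have kD k : (k <= N)%N -> `[0%R, (k%:R / N%:R : R)%R[%classic `<=` D.
  move=> kN x; rewrite /= !in_itv/= => /andP[-> /=] /lt_le_trans; apply.
  by rewrite ler_pdivrMr ?mul1r ?ler_nat// ltr0n.
have H k : (k <= N)%N -> (\int[mu]_(x in `[0%R, (k%:R / N%:R)%R[) phi x =
    \sum_(j < k) \int[mu]_(x in cell N j) phi x)%E.
  elim: k => [|k IH] kN; first by rewrite mul0r set_itvco0 integral_set0 big_ord0.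
  rewrite big_ord_recr/= -IH ?(ltnW kN)// itvS// ge0_integral_setU//.
  - exact: measurable_cell.
  - by rewrite -itvS//; apply: measurable_funS mphi => //; exact: kD.
  - by rewrite -itvS// => x /(kD _ kN); exact: phi0.
  - apply/disj_setPS => x [/=]; rewrite in_itv/= => /andP[_ xk] /andP[kx _].
    by have := lt_le_trans xk kx; rewrite ltxx.
by rewrite -H// divff// pnatr_eq0 -lt0n.
Qed.

(** For the last index j = N - 1 the arc passes through the point 1, and periodicity carries its
    second half to cell 0; hence the successor modulo N. *)
Lemma circle_param_arc N j : (1 < N)%N -> (j < N)%N ->
  circle_param (circ (R := R) @` `[(j%:R / N%:R)%R, (j.+2%:R / N%:R)%R[) =
  cell N j `|` cell N (j.+1 %% N).
Proof.
move=> N1 jN.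
have N0 : 0 < N%:R :> R by rewrite ltr0n ltnW.
have circT t : circ (t + 1) = circ t :> R[i] by rewrite circD circ1 mulr1.
apply/seteqP; split => [y [y01 [t]]|y] /=.
  rewrite in_itv/= ler_pdivrMr// ltr_pdivlMr// => /andP[jt tj] ty.
  have t0 : 0 <= t by rewrite -(pmulr_lge0 _ N0) (le_trans _ jt).
  have [t1|t1] := ltP t 1.
    have tD : t \in `[0%R, 1%R[ by rewrite in_itv/= t0.
    have -> : y = t by exact: circ_inj.
    have [tj1|tj1] := ltP t (j.+1%:R / N%:R); [left|right].
      by rewrite /cell/= tj1 ler_pdivrMr// jt.
    have jN' : (j.+1 < N)%N.
      rewrite -(ltr_nat R) -(mul1r N%:R) -ltr_pdivrMr//.
      exact: le_lt_trans tj1 t1.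
    by rewrite modn_small// /cell/= tj1 ltr_pdivlMr.
  (* From t >= 1 and t N < j + 2 follows N < j + 2, so only the last arc reaches beyond 1. *)
  have jE : j.+1 = N.
    apply/eqP; rewrite eqn_leq jN/= -ltnS -(ltr_nat R); apply: le_lt_trans tj.
    by rewrite ler_peMl// ltW.
  right; rewrite jE modnn.
  have tN : t - 1 < 1 / N%:R.
    move: tj; rewrite jE -ltr_pdivlMr// -[N.+1]addn1 natrD mulrDl divff ?gt_eqF//.
    by rewrite ltrBlDl.
  have tD : t - 1 \in `[0%R, 1%R[.
    rewrite in_itv/= subr_ge0 t1 (lt_le_trans tN)//.
    by rewrite ler_pdivrMr// mul1r ler1n ltnW.
  have -> : y = t - 1 by apply: circ_inj => //; rewrite -ty -[RHS]circT subrK.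
  by rewrite /cell/= mul0r subr_ge0 t1.
move=> yJ; split.
  have : D y by case: yJ => /cell_sub; apply => //; rewrite ltn_mod ltnW.
  by [].
case: yJ => [/andP[jy yj]|].
  exists y => //=; rewrite in_itv/= jy/= (lt_le_trans yj)//.
  by rewrite ler_wpM2r ?invr_ge0 ?ler0n// ler_nat.
have [jN' | Nj] := ltnP j.+1 N.
  rewrite modn_small// => /andP[jy yj]; exists y => //=.
  rewrite in_itv/= yj andbT (le_trans _ jy)//.
  by rewrite ler_wpM2r ?invr_ge0 ?ler0n// ler_nat.
have -> : j.+1 = N by apply/eqP; rewrite eqn_leq jN Nj.
rewrite modnn => /andP[]; rewrite mul0r => y0 y1.
exists (y + 1); last by rewrite circT.
have jE : j.+1%:R = N%:R :> R by congr _%:R; apply/eqP; rewrite eqn_leq jN Nj.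
rewrite /= in_itv/=; apply/andP; split.
  rewrite ler_pdivrMr// mulrDl mul1r -jE (le_trans (y:= j.+1%:R))// ?ler_nat//.
  by rewrite lerDr mulr_ge0.
by rewrite -[N.+1]addn1 natrD mulrDl divff ?gt_eqF// [ltRHS]addrC ltrD2r.
Qed.

Lemma measure_cell N j : (0 < N)%N -> mu (cell N j) = (N%:R^-1)%:E.
Proof.
move=> N0; rewrite cellE lebesgue_measure_itv/= lte_fin.
rewrite ltr_pM2r ?invr_gt0 ?ltr0n// ltr_nat ltnSn -EFinB.
by rewrite -mulrBl -natrB// subSnn mul1r.
Qed.

Lemma cell_next_disjoint N j : (1 < N)%N -> (j < N)%N ->
  cell N j `&` cell N (j.+1 %% N) = set0.
Proof.
move=> N1 jN; have [jN'|Nj] := ltnP j.+1 N; first by rewrite modn_small// cell_disjoint.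
have jE : j.+1 = N by apply/eqP; rewrite eqn_leq jN Nj.
rewrite jE modnn setIC cell_disjoint//.
by rewrite -ltnS jE.
Qed.

Lemma arc_measure N j : (1 < N)%N -> (j < N)%N ->
  circle_measure (circ (R := R) @` `[(j%:R / N%:R)%R, (j.+2%:R / N%:R)%R[) =
  (2 / N%:R)%:E.
Proof.
move=> N1 jN; rewrite /circle_measure circle_param_arc//.
rewrite measureU; [|exact: measurable_cell|exact: measurable_cell|].
  rewrite -[X in (X + _)%E]/(mu (cell N j)) -[X in (_ + X)%E]/(mu (cell N (j.+1 %% N))).
  by rewrite !measure_cell ?(ltnW N1)// -EFinD -mulr2n mulr_natl.
exact: cell_next_disjoint.
Qed.

End cells.

(** * Averages of trigonometric polynomials *)

Section smoothing.
Context {R : realType}.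
Implicit Types (N M j : nat) (x y t : R) (g : nat -> R[i]).
Local Notation mu := (@lebesgue_measure R).
Local Notation Re := (@complex.Re R).

Definition trig_prim g M x : R[i] := \sum_(n < M) g n * circ_prim n%:R x.

Lemma cintegrable_circ (r a b : R) : cintegrable `[a, b[ (fun x => circ (r * x)).
Proof.
have mI : measurable (`[a, b[ : set R) by [].
have [mr mi] := cmeasurable_circ r mI.
have bI : (mu (`[a, b[ : set R) < +oo)%E.
  by rewrite lebesgue_measure_itv/=; case: ifPn => // _; rewrite -EFinB ltry.
split; apply: measurable_bounded_integrable => //.
- exists 1; split => // x x1 y _ /=; rewrite (le_trans _ (ltW x1))//; exact: cos_max.
- exists 1; split => // x x1 y _ /=; rewrite (le_trans _ (ltW x1))//; exact: sin_max.
Qed.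

Lemma cintegrable_trig g M (a b : R) : cintegrable `[a, b[ (trig g M).
Proof.
apply: cintegrable_sum => // n.
rewrite (_ : (fun x => _) = fun x => circ (n%:R * x) * g n).
  by apply: cintegrableZ => //; exact: cintegrable_circ.
by apply/funext => x; rewrite circX mulrC.
Qed.

Lemma cintegral_trig g M (a b : R) : a <= b ->
  cintegral `[a, b[ (trig g M) = trig_prim g M b - trig_prim g M a.
Proof.
move=> ab.
have E (n : 'I_M) : (fun x => g n * circ x ^+ n) = (fun x => circ (n%:R * x) * g n).
  by apply/funext => x; rewrite circX mulrC.
rewrite cintegral_sum//; last first.
  by move=> n; rewrite E; apply: cintegrableZ => //; exact: cintegrable_circ.
rewrite /trig_prim -sumrB; apply: eq_bigr => n _.
rewrite E cintegralZ//; last exact: cintegrable_circ.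
by rewrite cintegral_circ// -mulrBr mulrC.
Qed.

Lemma Re_trig_prim_le g M (a b : R) : a <= b ->
  (`|Re (trig_prim g M b - trig_prim g M a)|%:E <=
    \int[mu]_(x in `[a, b[) `|Re (trig g M x)|%:E)%E.
Proof.
move=> ab; rewrite -cintegral_trig//=.
have [iR _] := cintegrable_trig g M a b.
have mI : measurable (`[a, b[ : set R) by [].
have := @le_normr_Rintegral _ _ R mu _ _ mI iR.
rewrite -lee_fin => /le_trans; apply; rewrite /Rintegral fineK//.
apply: integrable_fin_num => //.
by have := integrable_norm iR.
Qed.

Lemma trig_prim_shift g M x y : trig_prim g M (x + 1) - trig_prim g M (y + 1) =
  trig_prim g M x - trig_prim g M y.
Proof.
rewrite /trig_prim -!sumrB; apply: eq_bigr => n _.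
by rewrite -!mulrBr circ_prim_shift// mulr1 circ_nat.
Qed.

Lemma Re_integral_cell_le g M N j (a b : R) : a <= b ->
  j%:R / N%:R <= a -> b <= j.+1%:R / N%:R ->
  (`|Re (trig_prim g M b - trig_prim g M a)|%:E <=
    \int[mu]_(x in cell N j) `|Re (trig g M x)|%:E)%E.
Proof.
move=> ab ja bj; apply: le_trans (Re_trig_prim_le g M ab) _.
apply: ge0_subset_integral => //.
- exact: measurable_cell.
- apply/measurable_EFinP; apply: measurableT_comp => //.
  exact: (cmeasurable_trig g M (measurable_cell N j)).1.
- by move=> x /=; rewrite in_itv/= => /andP[ax xb]; rewrite /cell/= (le_trans ja)//
  (lt_le_trans xb).
Qed.

(* c_n = N int_0^(1/N) e^(2 i pi n t) dt *)
Definition smooth_coef N n : R[i] :=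
  N%:R * (circ_prim n%:R N%:R^-1 - circ_prim n%:R 0).

Definition smooth N M g : nat -> R[i] := trunc M (fun n => smooth_coef N n * g n).

(** The right-hand side is the average of [trig g M] over [x, x + 1/N]; by [circ_primB] its n-th
    coefficient is that of g times [smooth_coef N n]. *)
Lemma trig_smooth N M g x : trig (smooth N M g) M x =
  N%:R * (trig_prim g M (x + N%:R^-1) - trig_prim g M x).
Proof.
rewrite trig_trunc /trig /trig_prim -sumrB mulr_sumr; apply: eq_bigr => n _.
by rewrite -mulrBr circ_primB circX /smooth_coef; ring.
Qed.

(** The interval of averaging is cut at the right end p of the cell: the first piece stays in cell
    j, the second in the next one. When p = 1 the second piece is moved to cell 0 by
    [trig_prim_shift]. *)
Lemma Re_trig_smooth_le N M g j x : (0 < N)%N -> (j < N)%N -> cell N j x ->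
  (`|Re (trig (smooth N M g) M x)|%:E <= N%:R%:E *
    (\int[mu]_(y in cell N j) `|Re (trig g M y)|%:E +
     \int[mu]_(y in cell N (j.+1 %% N)) `|Re (trig g M y)|%:E))%E.
Proof.
move=> N0 jN /andP[jx xj]; rewrite trig_smooth.
have NR0 : 0 < N%:R :> R by rewrite ltr0n.
have -> : Re (N%:R * (trig_prim g M (x + N%:R^-1) - trig_prim g M x)) =
    N%:R * Re (trig_prim g M (x + N%:R^-1) - trig_prim g M x).
  by rewrite cReM -(rmorph_nat (real_complex R)) /= mul0r subr0.
rewrite normrM ger0_norm// EFinM lee_wpmul2l//.
set p := j.+1%:R / N%:R : R.
have pE : p = j%:R / N%:R + N%:R^-1 by rewrite /p -addn1 natrD mulrDl mul1r.
rewrite (_ : trig_prim g M (x + N%:R^-1) - trig_prim g M x =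
  (trig_prim g M p - trig_prim g M x) + (trig_prim g M (x + N%:R^-1)
    - trig_prim g M p)); last first.
  by ring.
rewrite cReD; apply: (@le_trans _ _ (`|Re (trig_prim g M p - trig_prim g M x)|%:E +
   `|Re (trig_prim g M (x + N%:R^-1) - trig_prim g M p)|%:E)%E).
  by rewrite -EFinD lee_fin ler_normD.
apply: leeD; first by apply: Re_integral_cell_le => //; exact: ltW.
have px : p <= x + N%:R^-1 by rewrite pE lerD2r.
have [jN'|Nj] := ltnP j.+1 N.
  rewrite modn_small//; apply: Re_integral_cell_le => //.
  by rewrite -[j.+2]addn1 natrD mulrDl mul1r lerD2r ltW.
have jE : j.+1 = N by apply/eqP; rewrite eqn_leq jN Nj.
have p1 : p = 0 + 1 by rewrite /p jE divff ?gt_eqF// add0r.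
have p1' : p = 1 by rewrite p1 add0r.
have px1 : 1 <= x + N%:R^-1 by move: px; rewrite p1'.
have x1 : x <= 1 by move: (ltW xj); rewrite -/p p1'.
rewrite p1 -[x + N%:R^-1](subrK 1) trig_prim_shift jE modnn.
apply: Re_integral_cell_le; rewrite ?mul0r ?subr_ge0//.
by rewrite div1r lerBlDr addrC lerD2l.
Qed.

(** Recovers Cauchy-Schwarz from a family of linear inequalities: the choice l = A / E makes the
    first term equal to A. *)
Lemma mul_le_of_amgm (A E V : R) : 0 <= A -> 0 <= E -> 0 <= V ->
  (forall l, 0 < l -> 2 * A <= l * E + l^-1 * V) -> A ^+ 2 <= E * V.
Proof.
move=> A0 E0 V0 amgm.
have [->|An0] := eqVneq A 0; first by rewrite expr0n mulr_ge0.
have Ap : 0 < A by rewrite lt_def An0.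
have [E00|En0] := eqVneq E 0.
  (* With E = 0 and this l the hypothesis reads 2 A <= A V / (V + 1) <= A, which contradicts A >
     0. *)
  have Vp : 0 < (V + 1) / A by rewrite divr_gt0// ltr_wpDl.
  have := amgm _ Vp; rewrite E00 mulr0 add0r invf_div.
  have : A / (V + 1) * V <= A.
    by rewrite mulrAC ler_pdivrMr ?ltr_wpDl// ler_pM2l// lerDl.
  by move=> h1 h2; exfalso; lra.
have Ep : 0 < E by rewrite lt_def En0.
have := amgm (A / E) (divr_gt0 Ap Ep).
rewrite divfK// invf_div -(ler_pM2l Ap) => h.
have -> : E * V = A * (E / A * V) by field.
by move: h; rewrite mulrDr; nra.
Qed.

End smoothing.

Lemma measurable_funV d (T : measurableType d) (R : realType) (D : set T) (f : T -> R) :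
  measurable_fun D f -> measurable_fun D (fun x => (f x)^-1).
Proof.
(* Real powers are measurable, and f / |f|^2 is the inverse of f; at zeros of f both sides are 0 by
   convention. *)
move=> mf; rewrite (_ : (fun x => _) = fun x => f x * (`|f x| `^ (-1)) ^+ 2).
  apply: measurable_funM => //; apply: measurable_funX.
  apply: (measurableT_comp (f := (@powR R)^~ (-1))); first exact: measurable_powR.
  exact: measurableT_comp.
apply/funext => x; rewrite powR_inv1// exprVn real_normK ?num_real// expr2.
by have [->|f0] := eqVneq (f x) 0; rewrite ?mul0r ?invr0// invfM mulrA divff ?mul1r.
Qed.

(** * The weighted bound for averages *)

Section weighted_smoothing.
Context {R : realType}.
Variable W : R -> R.
Local Notation mu := (@lebesgue_measure R).
Local Notation D := (`[0%R, 1%R[%classic : set R).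
Local Notation Re := (@complex.Re R).
Local Notation Im := (@complex.Im R).
Implicit Types (F : R -> R[i]) (phi : R -> R) (g : nat -> R[i]).

Hypothesis iW : mu.-integrable D (EFin \o W).
Hypothesis W1 : forall x, D x -> 1 <= W x.

Definition next_cell N j := (j.+1 %% N)%N.

(** For N > 1, the integral over the arc from j/N to (j + 2)/N, split as in [circle_param_arc]. *)
Definition arc_integral N j phi : R :=
  \int[mu]_(x in cell N j) phi x + \int[mu]_(x in cell N (next_cell N j)) phi x.

Lemma next_cell_lt N j : (j < N)%N -> (next_cell N j < N)%N.
Proof. by move=> jN; rewrite ltn_mod (leq_ltn_trans _ jN). Qed.

Lemma integrable_cell N j phi : (j < N)%N -> mu.-integrable D (EFin \o phi) ->
  mu.-integrable (cell N j) (EFin \o phi).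
Proof.
by move=> jN; apply: integrableS => //; [exact: measurable_cell|exact: cell_sub].
Qed.

Lemma arc_integral_le N j phi psi : (j < N)%N ->
  mu.-integrable D (EFin \o phi) -> mu.-integrable D (EFin \o psi) ->
  (forall x, D x -> phi x <= psi x) -> arc_integral N j phi <= arc_integral N j psi.
Proof.
move=> jN iphi ipsi le; have nN := next_cell_lt jN.
by apply: lerD; apply: le_Rintegral => //; (try exact: measurable_cell);
  (try exact: integrable_cell) => x /cell_sub Dx; apply: le; apply: Dx.
Qed.

Lemma arc_integral_ge0 N j phi : (j < N)%N -> (forall x, D x -> 0 <= phi x) ->
  0 <= arc_integral N j phi.
Proof.
move=> jN phi0; have nN := next_cell_lt jN.
by apply: addr_ge0; apply: Rintegral_ge0 => x /cell_sub Dx; apply: phi0; apply: Dx.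
Qed.

Lemma arc_integralD N j phi psi : (j < N)%N ->
  mu.-integrable D (EFin \o phi) -> mu.-integrable D (EFin \o psi) ->
  arc_integral N j (fun x => phi x + psi x) = arc_integral N j phi + arc_integral N j psi.
Proof.
move=> jN iphi ipsi; have nN := next_cell_lt jN.
rewrite /arc_integral !RintegralD//; try exact: measurable_cell;
  try exact: integrable_cell; ring.
Qed.

Lemma arc_integralZ N j phi (c : R) : (j < N)%N -> mu.-integrable D (EFin \o phi) ->
  arc_integral N j (fun x => c * phi x) = c * arc_integral N j phi.
Proof.
move=> jN iphi; have nN := next_cell_lt jN.
rewrite /arc_integral !RintegralZl//; try exact: measurable_cell;
  try exact: integrable_cell; ring.
Qed.

Lemma integrableMl_cst phi (c : R) : mu.-integrable D (EFin \o phi) ->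
  mu.-integrable D (EFin \o (fun x => c * phi x)).
Proof.
move=> iphi; rewrite (_ : _ \o _ = fun x => (phi x * c)%:E).
  by apply: integrableMr_cst.
by apply/funext => x/=; rewrite mulrC.
Qed.

Lemma integrableD_EFin phi psi : mu.-integrable D (EFin \o phi) ->
  mu.-integrable D (EFin \o psi) ->
  mu.-integrable D (EFin \o (fun x => phi x + psi x)).
Proof.
move=> ip iq; rewrite (_ : _ \o _ = (EFin \o phi) \+ (EFin \o psi))%E//.
exact: integrableD.
Qed.

Lemma Rintegral_cell_le N j phi : (j < N)%N -> mu.-integrable D (EFin \o phi) ->
  (forall x, D x -> 0 <= phi x) ->
  \int[mu]_(x in cell N j) phi x <= \int[mu]_(x in D) phi x.
Proof.
move=> jN iphi phi0; rewrite /Rintegral fine_le//.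
- by apply: integrable_fin_num; [exact: measurable_cell|exact: integrable_cell].
- exact: integrable_fin_num.
apply: ge0_subset_integral => //; first exact: measurable_cell.
- exact: measurable_int iphi.
- exact: cell_sub.
Qed.

Lemma sum_Rintegral_cell N phi : (0 < N)%N -> mu.-integrable D (EFin \o phi) ->
  (forall x, D x -> 0 <= phi x) ->
  \sum_(j < N) \int[mu]_(x in cell N j) phi x = \int[mu]_(x in D) phi x.
Proof.
move=> N0 iphi phi0; apply: EFin_inj; rewrite -sumEFin /Rintegral fineK; last first.
  exact: integrable_fin_num.
rewrite (integral_cells N0)//.
  apply: eq_bigr => j _; rewrite fineK//.
  by apply: integrable_fin_num; [exact: measurable_cell|exact: integrable_cell].
exact: measurable_int iphi.
Qed.

(** [next_cell] permutes the cells cyclically, so every cell is counted twice. *)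
Lemma sum_arc_integral N phi : (0 < N)%N -> mu.-integrable D (EFin \o phi) ->
  (forall x, D x -> 0 <= phi x) ->
  \sum_(j < N) arc_integral N j phi = 2 * \int[mu]_(x in D) phi x.
Proof.
move=> N0 iphi phi0; rewrite big_split/= sum_Rintegral_cell//.
have -> : \sum_(j < N) \int[mu]_(x in cell N (next_cell N j)) phi x =
          \sum_(j < N) \int[mu]_(x in cell N j) phi x.
  case: N N0 => // N _; rewrite big_ord_recr [RHS]big_ord_recl addrC/=.
  rewrite /next_cell modnn; congr (_ + _); apply: eq_bigr => j _.
  by rewrite modn_small// ltnS.
by rewrite sum_Rintegral_cell//; ring.
Qed.

Lemma integrable_invW : mu.-integrable D (EFin \o (fun x => (W x)^-1)).
Proof.
have W0 x : D x -> 0 < W x by move=> /W1; exact: lt_le_trans.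
have mW : measurable_fun D W by apply/measurable_EFinP; exact: measurable_int iW.
apply: le_integrable iW => //.
  by apply/measurable_EFinP; exact: measurable_funV.
move=> x Dx /=; have Wx := W0 x Dx; rewrite lee_fin !ger0_norm ?invr_ge0 ?(ltW Wx)//.
by rewrite (le_trans _ (W1 Dx))// invf_le1// W1.
Qed.

(** Cauchy-Schwarz for |Re F| W^(1/2) and W^(-1/2), obtained by integrating 2 |Re F| <= l |Re F|^2 W
    + 1 / (l W) and optimizing over l. *)
Lemma arc_cauchy_schwarz N j F : (j < N)%N -> cmeasurable D F ->
  mu.-integrable D (EFin \o (fun x => sqmod (F x) * W x)) ->
  mu.-integrable D (EFin \o (fun x => `|Re (F x)|)) ->
  arc_integral N j (fun x => `|Re (F x)|) ^+ 2 <=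
  arc_integral N j (fun x => sqmod (F x) * W x) * arc_integral N j (fun x => (W x)^-1).
Proof.
move=> jN mF iF iRe; have iV := integrable_invW.
have W0 x : D x -> 0 < W x by move=> /W1; exact: lt_le_trans.
apply: mul_le_of_amgm.
- by apply: arc_integral_ge0.
- by apply: arc_integral_ge0 => // x /W0 /ltW ?; rewrite mulr_ge0// sqmod_ge0.
- by apply: arc_integral_ge0 => // x /W0 /ltW ?; rewrite invr_ge0.
move=> l l0; rewrite -!arc_integralZ// -arc_integralD//; try exact: integrableMl_cst.
apply: arc_integral_le => //; first exact: integrableMl_cst.
  by apply: integrableD_EFin; exact: integrableMl_cst.
move=> x /W0 Wx; apply: (@le_trans _ _ (l * (`|Re (F x)| ^+ 2 * W x) + l^-1 * (W x)^-1)).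
  rewrite -subr_ge0.
  have -> : l * (`|Re (F x)| ^+ 2 * W x) + l^-1 * (W x)^-1 - 2 * `|Re (F x)| =
    (l * W x)^-1 * (l * W x * `|Re (F x)| - 1) ^+ 2 by field; rewrite !gt_eqF.
  by rewrite mulr_ge0 ?sqr_ge0// invr_ge0 mulr_ge0// ltW.
rewrite lerD2r ler_wpM2l ?(ltW l0)// ler_wpM2r ?(ltW Wx)//.
by rewrite real_normK ?num_real// /sqmod lerDl sqr_ge0.
Qed.

(** Replacing the polynomial by F costs at most 1/N on each of the two cells, hence 2 after
    multiplication by N; then (N A + 2)^2 <= 2 N^2 A^2 + 8, and [arc_cauchy_schwarz] bounds A^2. *)
Lemma Re_trig_smooth_sqr_le N M g F j x : (0 < N)%N -> (j < N)%N -> cell N j x ->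
  cmeasurable D F ->
  mu.-integrable D (EFin \o (fun x => sqmod (F x) * W x)) ->
  mu.-integrable D (EFin \o (fun x => `|Re (F x)|)) ->
  mu.-integrable D (EFin \o (fun x => `|Re (trig g M x - F x)|)) ->
  \int[mu]_(x in D) `|Re (trig g M x - F x)| <= N%:R^-1 ->
  Re (trig (smooth N M g) M x) ^+ 2 <=
    2 * N%:R ^+ 2 * (arc_integral N j (fun x => sqmod (F x) * W x) *
                     arc_integral N j (fun x => (W x)^-1)) + 8.
Proof.
move=> N0 jN xj mF iF iRe id dN; have nN := next_cell_lt jN.
have NR0 : 0 < N%:R :> R by rewrite ltr0n.
have := Re_trig_smooth_le M g N0 jN xj.
have itrig : mu.-integrable D (EFin \o (fun x => `|Re (trig g M x)|)).
  by have [iR _] := cintegrable_trig g M 0 1; exact: integrable_norm iR.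
have fin k : (k < N)%N -> (\int[mu]_(y in cell N k)
  `|Re (trig g M y)|%:E)%E \is a fin_num.
  by move=> kN; apply: integrable_fin_num;
    [exact: measurable_cell|exact: integrable_cell].
rewrite -(fineK (fin _ jN)) -(fineK (fin _ nN)) -EFinD -EFinM lee_fin.
rewrite -/(arc_integral N j (fun y => `|Re (trig g M y)|)).
set T := arc_integral _ _ _ => RT.
set A := arc_integral N j (fun x => `|Re (F x)|).
have TA : T <= A + 2 * N%:R^-1.
  apply: (@le_trans _ _ (A + arc_integral N j (fun x => `|Re (trig g M x - F x)|))).
    rewrite -arc_integralD//; apply: arc_integral_le => //.
      exact: integrableD_EFin.
    by move=> y _; rewrite cReD cReN -[in leLHS](subrKC (Re (F y)) (Re (trig g M y)))
      ler_normD.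
  rewrite lerD2l mulr_natl mulr2n lerD// (le_trans _ dN)// Rintegral_cell_le//.
have A0 : 0 <= A by exact: arc_integral_ge0.
have CS := arc_cauchy_schwarz jN mF iF iRe.
have bnd : `|Re (trig (smooth N M g) M x)| <= N%:R * A + 2.
  rewrite (le_trans RT)// (le_trans (ler_wpM2l (ltW NR0) TA))// mulrDr.
  by rewrite mulrCA divff ?gt_eqF// mulr1.
rewrite -real_normK ?num_real//.
apply: (@le_trans _ _ ((N%:R * A + 2) ^+ 2)).
  by rewrite lerXn2r ?nnegrE// addr_ge0// mulr_ge0// ltW.
apply: (@le_trans _ _ (2 * N%:R ^+ 2 * A ^+ 2 + 8)).
  by have := sqr_ge0 (N%:R * A - 2); nra.
by rewrite lerD2r ler_wpM2l// mulr_ge0// sqr_ge0.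
Qed.

Lemma integrable_norm_le F (P : R[i] -> R) : cmeasurable D F ->
  measurable_fun D (fun x => P (F x)) -> (forall z, P z ^+ 2 <= sqmod z) ->
  mu.-integrable D (EFin \o (fun x => sqmod (F x) * W x)) ->
  mu.-integrable D (EFin \o (fun x => `|P (F x)|)).
Proof.
move=> mF mP Pz iF.
have i2 := integrableD_EFin iF iW.
apply: le_integrable i2 => //.
  by apply/measurable_EFinP; exact: measurableT_comp.
move=> x Dx /=; have Wx := W1 Dx; rewrite lee_fin normr_id.
have s0 := sqmod_ge0 (F x); rewrite [leRHS]ger0_norm; last first.
  by rewrite addr_ge0 ?mulr_ge0// (le_trans ler01).
(* Uses t <= t^2 + 1 and then W >= 1, so that the dominating function is |F|^2 W + W. *)
apply: (@le_trans _ _ (sqmod (F x) + 1)); last by rewrite lerD// ler_peMr.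
have := Pz (F x); rewrite -real_normK ?num_real//.
by have := sqr_ge0 (`|P (F x)| - 1); have := normr_ge0 (P (F x)); nra.
Qed.

Lemma sqmod_trig_smooth_le N M g F j x : (0 < N)%N -> (j < N)%N -> cell N j x ->
  cmeasurable D F ->
  mu.-integrable D (EFin \o (fun x => sqmod (F x) * W x)) ->
  \int[mu]_(x in D) `|Re (trig g M x - F x)| <= N%:R^-1 ->
  \int[mu]_(x in D) `|Im (trig g M x - F x)| <= N%:R^-1 ->
  sqmod (trig (smooth N M g) M x) <=
    4 * N%:R ^+ 2 * (arc_integral N j (fun x => sqmod (F x) * W x) *
                     arc_integral N j (fun x => (W x)^-1)) + 16.
Proof.
(* Since Re (-i z) = Im z and averaging is linear, the bound for imaginary parts is the one for real
   parts applied to -i g and -i F. *)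
move=> N0 jN xj mF iF dR dI; pose c : R[i] := 0 -i* 1.
have mI : measurable D by [].
have Rec z : Re (c * z) = Im z by rewrite cReM/= mul0r sub0r mulN1r opprK.
have sqc z : sqmod (c * z) = sqmod z by rewrite /sqmod !cReImE/=; ring.
have ReP (z : R[i]) : Re z ^+ 2 <= sqmod z by rewrite /sqmod lerDl sqr_ge0.
have mB : cmeasurable D (fun x => trig g M x - F x).
  by apply: cmeasurableB => //; exact: cmeasurable_trig.
have inorm (P : R[i] -> R) : measurable_fun D (fun x => P (trig g M x)) ->
    measurable_fun D (fun x => P (F x)) -> (forall z, P z ^+ 2 <= sqmod z) ->
    mu.-integrable D (EFin \o (fun x => `|P (trig g M x)|)) ->
    (forall z z', P (z - z') = P z - P z') ->
    mu.-integrable D (EFin \o (fun x => `|P (trig g M x - F x)|)).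
  move=> mPt mPF Pz it PB.
  have i2 := integrableD_EFin it (integrable_norm_le mF mPF Pz iF).
  apply: le_integrable i2 => //.
    apply/measurable_EFinP; apply: measurableT_comp => //.
    rewrite (_ : (fun x => _) = fun x => P (trig g M x) - P (F x)); last exact/funext.
    exact: measurable_funB.
  move=> y _ /=; rewrite lee_fin normr_id PB (le_trans (ler_normB _ _))//.
  by rewrite ler_norm.
have [itR itI] := cintegrable_trig g M 0 1.
have [mtR mtI] := cmeasurable_trig g M mI.
have iRe := integrable_norm_le mF mF.1 ReP iF.
have iRd := inorm Re mtR mF.1 ReP (integrable_norm itR)
  (fun z z' => etrans (cReD _ _) (congr1 _ (cReN _))).
have ImP (z : R[i]) : Im z ^+ 2 <= sqmod z by rewrite /sqmod lerDr sqr_ge0.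
have iIm := integrable_norm_le mF mF.2 ImP iF.
have iId := inorm Im mtI mF.2 ImP (integrable_norm itI)
  (fun z z' => etrans (cImD _ _) (congr1 _ (cImN _))).
have HR := Re_trig_smooth_sqr_le N0 jN xj mF iF iRe iRd dR.
have trigc u : trig (fun n => c * u n) M = fun x => c * trig u M x.
  by apply/funext => y; rewrite /trig mulr_sumr; apply: eq_bigr => n _; rewrite mulrA.
have smoothc : trig (smooth N M (fun n => c * g n))
  M = fun x => c * trig (smooth N M g) M x.
  rewrite /smooth !trig_trunc -trigc; congr trig; apply/funext => n.
  by rewrite mulrCA.
have HI := @Re_trig_smooth_sqr_le N M (fun n => c * g n) (fun x => c * F x) j x N0 jN xj.
move: HI; rewrite smoothc trigc Rec.
have -> : (fun y => sqmod (c * F y) * W y) = (fun y => sqmod (F y) * W y).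
  by apply/funext => y; rewrite sqc.
have -> : (fun y => `|Re (c * F y)|) = (fun y => `|Im (F y)|).
  by apply/funext => y; rewrite Rec.
have -> : (fun y => `|Re (c * trig g M y - c * F y)|)
  = (fun y => `|Im (trig g M y - F y)|).
  by apply/funext => y; rewrite -mulrBr Rec.
have mcF : cmeasurable D (fun y => c * F y).
  by apply: cmeasurableM => //; exact: cmeasurable_cst.
move=> /(_ mcF iF iIm iId dI) HI.
rewrite [sqmod (trig (smooth N M g) M x)]/sqmod.
by apply: le_trans (lerD HR HI) _; rewrite le_eqVlt; apply/orP; left; apply/eqP; ring.
Qed.

(* [C] is the Muckenhoupt constant, up to a factor. *)
Lemma wnorm_smooth_le N M g F (C : R) : (0 < N)%N ->
  cmeasurable D F ->
  mu.-integrable D (EFin \o (fun x => sqmod (F x) * W x)) ->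
  \int[mu]_(x in D) `|Re (trig g M x - F x)| <= N%:R^-1 ->
  \int[mu]_(x in D) `|Im (trig g M x - F x)| <= N%:R^-1 ->
  (forall j, (j < N)%N ->
    N%:R ^+ 2 * (arc_integral N j W * arc_integral N j (fun x => (W x)^-1)) <= C) ->
  (wnorm W (trig (smooth N M g) M) <=
    (8 * C * \int[mu]_(x in D) (sqmod (F x) * W x) + 16 * \int[mu]_(x in D) W x)%:E)%E.
Proof.
move=> N0 mF iF dR dI A2.
have W0 x : D x -> 0 <= W x by move=> /W1; exact: le_trans.
have mW : measurable_fun D W by apply/measurable_EFinP; exact: measurable_int iW.
have mP := cmeasurable_trig (smooth N M g) M (@measurable_itv R `[0%R, 1%R[).
have E0 x : D x -> 0 <= sqmod (F x) * W x by move=> /W0 ?; rewrite mulr_ge0// sqmod_ge0.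
have V0 x : D x -> 0 <= (W x)^-1 by move=> /W0 ?; rewrite invr_ge0.
have aux (n e v u : R) : 0 <= e -> n * (u * v) <= C -> 4 * n * (e * v) * u <= 4 * C * e.
  move=> e0 nC; rewrite (_ : _ * u = 4 * e * (n * (u * v))); last by ring.
  by rewrite (_ : 4 * C * e = 4 * e * C) ?ler_wpM2l ?mulr_ge0//; ring.
pose E j := arc_integral N j (fun x => sqmod (F x) * W x).
pose V j := arc_integral N j (fun x => (W x)^-1).
pose w j := \int[mu]_(x in cell N j) W x.
rewrite /wnorm (integral_cells N0)//; last 2 first.
- exact: measurable_sqmodM.
- by move=> x /W0 ?; rewrite lee_fin mulr_ge0// sqmod_ge0.
apply: (@le_trans _ _ (\sum_(j < N) (4 * C * E j + 16 * w j)%:E)%E).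
  apply: lee_sum => j _.
  have wE : (\int[mu]_(x in cell N j) (W x)%:E = (w j)%:E)%E.
    rewrite /w /Rintegral fineK//.
    by apply: integrable_fin_num; [exact: measurable_cell|exact: integrable_cell].
  have Ej : 0 <= E j by exact: arc_integral_ge0.
  have Vj : 0 <= V j by exact: arc_integral_ge0.
  have wj : 0 <= w j.
    by apply: Rintegral_ge0 => x /cell_sub Dx; apply: W0; exact: Dx.
  pose K := 4 * N%:R ^+ 2 * (E j * V j) + 16.
  have K0 : 0 <= K by rewrite addr_ge0// !mulr_ge0// sqr_ge0.
  apply: (@le_trans _ _ (K%:E * (w j)%:E)%E).
    rewrite -wE -ge0_integralZl//; last 3 first.
    - exact: measurable_cell.
    - by apply/measurable_EFinP; apply: measurable_funS mW => //; exact: cell_sub.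
    - by move=> x /cell_sub Dx; rewrite lee_fin; apply: W0; exact: Dx.
    apply: ge0_le_integral => //.
    - exact: measurable_cell.
    - by move=> x /cell_sub Dx; rewrite lee_fin mulr_ge0 ?sqmod_ge0//; apply: W0;
      exact: Dx.
    - apply: measurable_funS (measurable_sqmodM mW mP) => //; exact: cell_sub.
    - apply: measurable_funeM; apply/measurable_EFinP.
      by apply: measurable_funS mW => //; exact: cell_sub.
    move=> x xj; rewrite -EFinM lee_fin ler_wpM2r//.
      by apply: W0; exact: cell_sub xj.
    exact: sqmod_trig_smooth_le.
  rewrite -EFinM lee_fin /K mulrDl lerD2r.
  (* The cell is part of the arc, so the Muckenhoupt bound absorbs N^2 w_j V_j into C and leaves a
     term linear in the energy [E j]. *)
  have wW : w j <= arc_integral N j W.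
    rewrite /arc_integral lerDl; apply: Rintegral_ge0 => x /cell_sub Dx; apply: W0.
    by apply: Dx; exact: next_cell_lt.
  have := A2 j (ltn_ord j); rewrite -/(V j) => AC.
  have : N%:R ^+ 2 * (w j * V j) <= C.
    by apply: le_trans AC; rewrite ler_wpM2l ?sqr_ge0// ler_wpM2r.
  exact: aux.
(* The arcs count each cell twice, which turns 4 C into 8 C. *)
rewrite sumEFin lee_fin big_split/= -!mulr_sumr sum_arc_integral//.
by rewrite sum_Rintegral_cell// lerD2r; lra.
Qed.

End weighted_smoothing.

(** * Convergence of the averaged coefficients in l^2 *)

Section smoothing_convergence.
Context {R : realType}.
Implicit Types (N n M K : nat) (g : nat -> R[i]).
Local Notation mu := (@lebesgue_measure R).
Local Notation Re := (@complex.Re R).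
Local Notation Im := (@complex.Im R).

Lemma smooth_coefE N n :
  smooth_coef N n = N%:R * cintegral `[0, N%:R^-1[ (fun x : R => circ (n%:R * x)).
Proof. by rewrite cintegral_circ// invr_ge0. Qed.

Lemma average_close N (f : R -> R) (a e : R) : (0 < N)%N -> 0 <= e ->
  mu.-integrable `[0, N%:R^-1[ (EFin \o f) ->
  (forall t, 0 <= t < N%:R^-1 -> `|f t - a| <= e) ->
  `|N%:R * (\int[mu]_(x in `[0, N%:R^-1[) f x) - a| <= e.
Proof.
move=> N0 e0 iF fe; set I := `[0, N%:R^-1[%classic : set R.
have NR0 : 0 < N%:R :> R by rewrite ltr0n.
have mI : measurable I by exact: measurable_itv.
have muI : mu I = (N%:R^-1)%:E.
  by rewrite lebesgue_measure_itv/= lte_fin invr_gt0 NR0 oppr0 adde0.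
have icst (c : R) : mu.-integrable I (EFin \o (fun=> c)).
  apply: measurable_bounded_integrable => //.
    exact: (eq_ind_r (fun z => (z < +oo)%E) (ltry _) muI).
  by exists `|c|; split => [|x /ltW cx y _ /=]; rewrite ?num_real.
have cstE (c : R) : \int[mu]_(x in I) c = c * N%:R^-1.
  by rewrite Rintegral_cst//= [X in fine X]muI.
have -> : N%:R * (\int[mu]_(x in I) f x) - a = N%:R * \int[mu]_(x in I) (f x - a).
  by rewrite RintegralB// cstE mulrBr mulrCA divff ?mulr1// gt_eqF.
rewrite normrM (ger0_norm (ltW NR0)) mulrC -ler_pdivlMr//.
have iB : mu.-integrable I (EFin \o (fun x => f x - a)).
  by rewrite (_ : _ \o _ = (EFin \o f) \- (EFin \o fun=> a))%E//; exact: integrableB.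
apply: le_trans (@le_normr_Rintegral _ _ R mu _ _ mI iB) _.
rewrite -cstE; apply: le_Rintegral => //.
  exact: integrable_norm iB.
Qed.

Lemma smooth_coef_close N n (e : R) : (0 < N)%N -> 0 <= e ->
  (forall t, 0 <= t < N%:R^-1 -> `|Re (circ (n%:R * t)) - 1| <= e) ->
  (forall t, 0 <= t < N%:R^-1 -> `|Im (circ (n%:R * t))| <= e) ->
  sqmod (smooth_coef N n - 1) <= 2 * e ^+ 2.
Proof.
move=> N0 e0 re ie; rewrite smooth_coefE.
have [iR iI] := cintegrable_circ n%:R 0 (N%:R^-1 : R).
have h1 := average_close N0 e0 iR re.
have h2 : `|N%:R * (\int[mu]_(x in `[0, N%:R^-1[) Im (circ (n%:R * x))) - 0| <= e.
  by apply: average_close => // t /ie; rewrite subr0.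
rewrite /sqmod !cReImE -(rmorph_nat (real_complex R)) /= !mul0r subr0 addr0.
rewrite [leRHS]mulr_natl mulr2n lerD//.
  by rewrite -real_normK ?num_real// lerXn2r ?nnegrE.
by rewrite -real_normK ?num_real// lerXn2r ?nnegrE.
Qed.

Lemma smooth_coef_le N n : (0 < N)%N -> sqmod (smooth_coef N n - 1) <= 8 :> R.
Proof.
(* The trivial bounds |cos - 1| <= 2 and |sin| <= 2 hold for every t, which makes the estimate
   uniform in n. *)
move=> N0; apply: le_trans (@smooth_coef_close _ _ 2 N0 _ _ _) _ => //.
- move=> t _; rewrite (le_trans (ler_normB _ _))// normr1 -[leRHS]/(1 + 1) lerD2r.
  exact: cos_max.
- move=> t _; apply: (@le_trans _ _ 1); last by rewrite ler1n.
  exact: sin_max.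
- lra.
Qed.

Lemma smooth_coef_cvg n (e : R) : 0 < e ->
  exists N0, forall N, (N0 <= N)%N -> sqmod (smooth_coef N n - 1 : R[i]) <= e.
Proof.
(* As d <= 1, the error 2 d^2 is at most 2 d, hence at most e. *)
move=> e0; pose d := Num.min 1 (e / 2).
have d0 : 0 < d by rewrite lt_min ltr01 divr_gt0.
have /cvgrPdist_le /(_ _ d0) cR := @continuous_Re_circ R n%:R 0.
have /cvgrPdist_le /(_ _ d0) cI := @continuous_Im_circ R n%:R 0.
have [r /= r0 rP] := filterI cR cI.
exists (Num.bound r^-1).+1 => N Nr.
have N0 : (0 < N)%N by apply: leq_trans Nr.
have Nrr : N%:R^-1 <= r.
  rewrite -[leRHS]invrK lef_pV2 ?posrE ?invr_gt0 ?ltr0n//.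
  have rV : 0 <= r^-1 by rewrite invr_ge0 ltW.
  by rewrite (le_trans (ltW (archi_boundP rV)))// ler_nat ltnW.
have close t : 0 <= t < N%:R^-1 -> `|Re (circ (n%:R * t)) - 1| <= d /\
    `|Im (circ (n%:R * t))| <= d.
  move=> /andP[t0 tN].
  have : ball 0 r t by rewrite /ball/= sub0r normrN ger0_norm// (lt_le_trans tN).
  move=> /rP [h1 h2]; move: h1 h2.
  by rewrite !mulr0 cos0 sin0 /circ/= distrC sub0r normrN.
apply: le_trans (@smooth_coef_close _ _ d N0 (ltW d0) _ _) _.
- by move=> t /close[].
- by move=> t /close[].
have d1 : d <= 1 by rewrite ge_min lexx.
have de : d <= e / 2 by rewrite ge_min lexx orbT.
by rewrite -ler_pdivlMl// mulrC expr2 (le_trans _ de)// ler_piMl// ltW.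
Qed.

(** Below K the finitely many factors are uniformly close to 1; from K on, the error is at most 8
    times the tail of g, whether the coefficient is averaged or cut off by M. *)
Lemma l2sq_smooth_cvg g (e : R) : l2 R g -> 0 < e ->
  exists N0, forall N, (N0 <= N)%N ->
    exists M0, forall M, (M0 <= M)%N -> (l2sq (seqB (smooth N M g) g) <= e%:E)%E.
Proof.
move=> gl2 e0; have e16 : 0 < e / 16 by rewrite divr_gt0.
have [K KP] := l2sq_sub_trunc_cvg gl2 e16.
pose L := fine (l2sq g).
have LE : l2sq g = L%:E by rewrite fineK// ge0_fin_numE// l2sq_ge0.
have L0 : 0 <= L by rewrite fine_ge0// l2sq_ge0.
have eL : 0 < e / 2 / (L + 1) by rewrite !divr_gt0// ltr_wpDl.
have /choice[N_ N_P] := fun n => smooth_coef_cvg n eL.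
(* The sum exceeds each threshold [N_ n] with n < K, and the successor makes N positive. *)
exists (\sum_(n < K) N_ n).+1 => N NK; exists K => M KM.
have N0 : (0 < N)%N by apply: leq_trans NK.
apply: (@le_trans _ _ ((e / 2 / (L + 1))%:E * l2sq g + 8%R%:E * l2sq (seqB g (trunc K g)))%E).
  apply: l2sq_le_comb => //; first exact: ltW.
  move=> n; rewrite /seqB /smooth /trunc.
  have s0 z : 0 <= sqmod z :> R by exact: sqmod_ge0.
  have [nK|Kn] := ltnP n K.
    rewrite (leq_trans nK KM) subrr (_ : sqmod 0 = 0) ?mulr0 ?addr0; last first.
      by rewrite /sqmod/= expr0n addr0.
    rewrite (_ : _ - g n = (smooth_coef N n - 1) * g n); last by ring.
    rewrite sqmodM ler_wpM2r//; apply: N_P; apply: leq_trans (ltnW NK).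
    by rewrite (bigD1 (Ordinal nK))//= leq_addr.
  rewrite subr0; apply: ler_wpDl; first by rewrite mulr_ge0// ltW.
  case: ifP => _; last by rewrite sub0r sqmodN ler_peMl// ler1n.
  rewrite (_ : _ - g n = (smooth_coef N n - 1) * g n); last by ring.
  by rewrite sqmodM ler_wpM2r// smooth_coef_le.
apply: (@le_trans _ _ ((e / 2)%:E + (e / 2)%:E)%E); last by rewrite -EFinD -splitr.
apply: leeD.
  rewrite LE -EFinM lee_fin mulrAC ler_pdivrMr ?ltr_wpDl//.
  by rewrite ler_wpM2l ?lerDl// ltW// divr_gt0.
apply: (@le_trans _ _ (8%R%:E * (e / 16)%:E)%E); first by rewrite lee_wpmul2l// KP.
by rewrite -EFinM lee_fin; lra.
Qed.

End smoothing_convergence.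

(** * The weight on the unit interval *)

Section weight.
Context {R : realType}.
Variable w : R[i] -> R.
Hypothesis w_L1 : circle_integrable w.
Hypothesis w_ge1 : circle_ae (fun z => 1 <= w z).
Local Notation mu := (@lebesgue_measure R).
Local Notation D := (`[0%R, 1%R[%classic : set R).

(* [w >= 1] holds only almost everywhere; replacing [w] by [max 1 w] changes no
   integral and gives the bound everywhere. *)
Definition weight (x : R) : R := Num.max 1 (w (circ x)).

Lemma weight_ge1 x : 1 <= weight x.
Proof. by rewrite le_max lexx. Qed.

Lemma weight_ge0 x : 0 <= weight x.
Proof. exact: le_trans ler01 (weight_ge1 x). Qed.

Lemma measurable_w : measurable_fun D (fun x => w (circ x)).
Proof.
move: w_L1; rewrite /circle_integrable circle_paramE => iw.
by apply/measurable_EFinP; exact: measurable_int iw.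
Qed.

Lemma measurable_weight : measurable_fun D weight.
Proof. by apply: measurable_maxr; [exact: measurable_cst|exact: measurable_w]. Qed.

Lemma weight_ae : {ae mu, forall x, D x -> w (circ x) = weight x}.
Proof.
move: w_ge1; rewrite /circle_ae circle_paramE.
by apply: filterS; [exact: (ae_filter_ringOfSetsType mu)|move=> x /[apply] w1;
  rewrite /weight max_r].
Qed.

Lemma integrable_weight : mu.-integrable D (EFin \o weight).
Proof.
have iw := w_L1; rewrite /circle_integrable circle_paramE in iw.
have i1 := @circle_integrable1 R; rewrite /circle_integrable circle_paramE in i1.
have mD : measurable D by [].
have i2 := @integrableD _ _ _ mu _ mD _ _ i1 (integrable_abse iw).
apply: le_integrable i2 => //; first by apply/measurable_EFinP; exact: measurable_weight.
move=> x _ /=; rewrite lee_fin ger0_norm ?weight_ge0//.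
rewrite ger0_norm ?addr_ge0// /weight ge_max lerDl normr_ge0/=.
by rewrite (le_trans (ler_norm _))// lerDr.
Qed.

Lemma wnorm_weight F : cmeasurable D F ->
  wnorm (fun x => w (circ x)) F = wnorm weight F.
Proof.
move=> mF; apply: ae_eq_integral => //.
- by apply: measurable_sqmodM => //; exact: measurable_w.
- by apply: measurable_sqmodM => //; exact: measurable_weight.
by apply: (@filterS _ _ (ae_filter_ringOfSetsType mu) _ _ _ weight_ae) => x /[apply] ->.
Qed.

Lemma wnorm1_le_weight F : cmeasurable D F ->
  (wnorm (fun=> 1%R) F <= wnorm weight F)%E.
Proof.
move=> mF; apply: ge0_le_integral => //.
- by move=> x _; rewrite lee_fin mulr1 sqmod_ge0.
- exact: measurable_sqmodM.
- by apply: measurable_sqmodM => //; exact: measurable_weight.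
by move=> x _; rewrite lee_fin ler_wpM2l ?sqmod_ge0// weight_ge1.
Qed.

Lemma circle_integral_arc N j (f : R[i] -> R) (phi : R -> R) : (1 < N)%N -> (j < N)%N ->
  mu.-integrable D (EFin \o phi) -> measurable_fun D (fun x => f (circ x)) ->
  (forall x, D x -> 0 <= phi x) ->
  {ae mu, forall x, D x -> f (circ x) = phi x} ->
  circle_integral (circ (R := R) @` `[(j%:R / N%:R)%R, (j.+2%:R / N%:R)%R[) f =
  (arc_integral N j phi)%:E.
Proof.
move=> N1 jN iphi mf phi0 fphi; have nN := next_cell_lt jN.
have mphi : measurable_fun D phi by apply/measurable_EFinP; exact: measurable_int iphi.
have JD : cell N j `|` cell N (j.+1 %% N) `<=` D.
  by move=> x [|]; exact: cell_sub.
have mJ : measurable (cell N j `|` cell N (j.+1 %% N) : set R).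
  by apply: measurableU; exact: measurable_cell.
rewrite /circle_integral circle_param_arc//.
rewrite (@ae_eq_integral _ _ _ mu _ (fun x => (phi x)%:E))//; last 3 first.
- by apply/measurable_EFinP; exact: measurable_funS mf.
- by apply/measurable_EFinP; exact: measurable_funS mphi.
- by apply: (@filterS _ _ (ae_filter_ringOfSetsType mu) _ _ _ fphi) => x fx Jx;
  rewrite fx//; exact: JD.
rewrite ge0_integral_setU//; last 5 first.
- exact: measurable_cell.
- exact: measurable_cell.
- by apply/measurable_EFinP; exact: measurable_funS mphi.
- by move=> x /JD; exact: phi0.
- by apply/disj_setPS; rewrite cell_next_disjoint.
rewrite /arc_integral EFinD /Rintegral !fineK//; apply: integrable_fin_num.
- exact: measurable_cell.
- exact: integrable_cell.
- exact: measurable_cell.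
- exact: integrable_cell.
Qed.

Lemma muckenhoupt_arc_integral : muckenhoupt w ->
  exists C : R, forall N j, (1 < N)%N -> (j < N)%N ->
    N%:R ^+ 2 * (arc_integral N j weight * arc_integral N j (fun x => (weight x)^-1))
      <= C.
Proof.
rewrite /muckenhoupt; set A := [set _ | _ in _] => supA.
have [C CP] : exists C : R, forall x, A x -> (x <= C%:E)%E.
  move: supA; case: (ereal_sup A) (ereal_sup_ubound (S := A)) => [C| |] ub // _.
    by exists C.
  by exists 0 => x /ub; rewrite leeNy_eq => /eqP ->; rewrite leNye.
(* The arc has measure 2/N, so the normalization m(X)^-2 is N^2 / 4. *)
exists (4 * C) => N j N1 jN.
pose X := circ (R := R) @` `[(j%:R / N%:R)%R, (j.+2%:R / N%:R)%R[.
have NR0 : 0 < N%:R :> R by rewrite ltr0n ltnW.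
have : A ((fine (circle_measure X) ^- 2)%R%:E * circle_integral X w
                   * circle_integral X (fun z => ((w z)^-1)%R))%E.
  exists X => //; split; last by rewrite /X arc_measure// lte_fin divr_gt0.
  by exists `[(j%:R / N%:R)%R, (j.+2%:R / N%:R)%R[%classic; split => //;
    exact: interval_is_interval.
move=> /CP; rewrite arc_measure//.
rewrite (@circle_integral_arc _ _ _ weight)//; last 4 first.
- exact: integrable_weight.
- exact: measurable_w.
- by move=> x _; exact: weight_ge0.
- exact: weight_ae.
have iV := integrable_invW integrable_weight (fun x _ => weight_ge1 x).
rewrite (@circle_integral_arc _ _ _ (fun x => (weight x)^-1))//; last 3 first.
- by apply: measurable_funV; exact: measurable_w.
- by move=> x _; rewrite invr_ge0 weight_ge0.
- by apply: (@filterS _ _ (ae_filter_ringOfSetsType mu) _ _ _ weight_ae) => x /[apply] ->.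
rewrite -!EFinM lee_fin /= => le.
have := ler_wpM2l (_ : 0 <= 4) le => /(_ (ler0n _ 4)); apply: le_trans.
rewrite le_eqVlt; apply/orP; left; apply/eqP.
by field; rewrite gt_eqF.
Qed.

End weight.

(** * The closure of the form *)

Section closure.
Context {R : realType}.
Variable w : R[i] -> R.
Hypothesis w_L1 : circle_integrable w.
Hypothesis w_ge1 : circle_ae (fun z => 1 <= w z).
Local Notation mu := (@lebesgue_measure R).
Local Notation D := (`[0%R, 1%R[%classic : set R).
Local Notation W := (weight w).
Local Notation Re := (@complex.Re R).
Implicit Types (g u v : nat -> R[i]) (F G : R -> R[i]).

Let mW := measurable_weight w_L1.
Let W0 x : D x -> 0 <= W x := fun _ => weight_ge0 w x.

Definition energy u : R := Re (toeplitz_form w u).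

Lemma energyE u : finite_seqs R u -> (energy u)%:E = wnorm W (finite_trig u).
Proof.
move=> fu; have [_] := toeplitz_form_wnorm w_L1 fu.
by rewrite wnorm_weight//; exact: cmeasurable_finite_trig.
Qed.

Lemma energy_ge0 u : finite_seqs R u -> 0 <= energy u.
Proof. by move=> fu; rewrite -lee_fin energyE//; exact: wnorm_ge0. Qed.

Lemma wnorm_comb F G (a b : R) : cmeasurable D F -> cmeasurable D G -> 0 <= a -> 0 <= b ->
  (a%:E * wnorm W F + b%:E * wnorm W G =
   \int[mu]_(x in D) ((a * sqmod (F x) + b * sqmod (G x)) * W x)%:E)%E.
Proof.
move=> mF mG a0 b0.
have s0 H x : D x -> (0 <= (sqmod (H x : R[i]) * W x)%:E)%E.
  by move=> /W0 ?; rewrite lee_fin mulr_ge0// sqmod_ge0.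
have mFW := measurable_sqmodM mW mF; have mGW := measurable_sqmodM mW mG.
rewrite /wnorm -!ge0_integralZl//; try exact: s0.
rewrite -ge0_integralD//.
- by apply: eq_integral => x _; rewrite -!EFinM -EFinD; congr _%:E; ring.
- by move=> x Dx; rewrite mule_ge0// s0.
- exact: measurable_funeM.
- by move=> x Dx; rewrite mule_ge0// s0.
- exact: measurable_funeM.
Qed.

Lemma energy_parallelogram u v : finite_seqs R u -> finite_seqs R v ->
  energy (seqB u v) = 2 * energy u + 2 * energy v - 4 * energy (midpoint u v).
Proof.
move=> fu fv; have fB := finite_seqsB fu fv; have fm := finite_midpoint fu fv.
(* Without subtraction both sides are integrals of non-negative functions, and the law can be
   checked pointwise. *)
suff : energy (seqB u v) + 4 * energy (midpoint u v) = 2 * energy u + 2 * energy v.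
  by move=> <-; rewrite addrK.
apply: EFin_inj; rewrite -[energy (seqB _ _)]mul1r !EFinD !EFinM !energyE//.
have mt := @cmeasurable_finite_trig R.
rewrite !wnorm_comb//; apply: eq_integral => x _; congr (_ * _)%:E.
rewrite finite_trigB// finite_trig_comb//.
rewrite (_ : _^-1 = (2^-1 : R)%:C); last by rewrite fmorphV/= rmorph_nat.
by rewrite /sqmod !cReImE/=; field.
Qed.

Lemma form_norm_sqr u : finite_seqs R u -> form_norm (toeplitz_form w) u ^+ 2 = energy u.
Proof. by move=> fu; rewrite sqr_sqrtr// energy_ge0. Qed.

Lemma form_cauchyP (u : nat -> nat -> R[i]) : (forall k, finite_seqs R (u k)) ->
  form_cauchy (toeplitz_form w) u <->
  (forall e : R, 0 < e -> exists N, forall k l, (N <= k)%N -> (N <= l)%N ->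
    energy (seqB (u k) (u l)) <= e).
Proof.
move=> fu; have fB k l : finite_seqs R (seqB (u k) (u l)) by exact: finite_seqsB.
split => cu e e0.
  have e1 : 0 < Num.sqrt e by rewrite sqrtr_gt0.
  have [N NP] := cu _ e1; exists N => k l Nk Nl.
  rewrite -form_norm_sqr// -(sqr_sqrtr (ltW e0)) lerXn2r ?nnegrE ?sqrtr_ge0//.
  by rewrite ltW// NP.
have e1 : 0 < (e / 2) ^+ 2 by rewrite exprn_gt0// divr_gt0.
have [N NP] := cu _ e1; exists N => k l Nk Nl.
apply: (@le_lt_trans _ _ (e / 2)); last by rewrite ltr_pdivrMr// ltr_pMr// ltr1n.
rewrite -(@ler_pXn2r _ 2%N) ?nnegrE ?sqrtr_ge0//; last by rewrite ltW// divr_gt0.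
by rewrite form_norm_sqr// NP.
Qed.

(** For fixed k, the differences u_l - u_k have energy at most e/2 for large l and tend to F - u_k
    in L^2(m); lower semicontinuity, with its factor 2, gives e. *)
Lemma form_cauchy_cvg F (u : nat -> nat -> R[i]) : cmeasurable D F ->
  (forall k, finite_seqs R (u k)) -> form_cauchy (toeplitz_form w) u ->
  (forall e : R, 0 < e -> exists N, forall k, (N <= k)%N ->
    (wnorm (fun=> 1%R) (fun x => F x - finite_trig (u k) x)%R <= e%:E)%E) ->
  forall e : R, 0 < e -> exists N, forall k, (N <= k)%N ->
    (wnorm W (fun x => F x - finite_trig (u k) x)%R <= e%:E)%E.
Proof.
move=> mF fu /(form_cauchyP fu) cu Fu e e0.
have e2 : 0 < e / 2 by rewrite divr_gt0.
have [N NP] := cu _ e2; exists N => k Nk.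
have mt := @cmeasurable_finite_trig R.
rewrite -[e](@divfK _ 2)// mulrC.
apply: (@wnorm_lower_semicontinuous _ W _ (fun l x => finite_trig (u l)
  x - finite_trig (u k) x)) => //.
- exact: cmeasurableB.
- by move=> l; exact: cmeasurableB.
move=> eta eta0; have [M MP] := Fu _ eta0; exists (maxn N M); split.
  rewrite (_ : (fun x => _) = finite_trig (seqB (u (maxn N M)) (u k))); last first.
    by apply/funext => x; rewrite finite_trigB.
  rewrite -energyE; last exact: finite_seqsB.
  by rewrite lee_fin NP// leq_maxl.
rewrite (_ : _ \- _ = (fun x => F x - finite_trig (u (maxn N M)) x)).
  by rewrite MP// leq_maxr.
by apply/funext => x /=; ring.
Qed.

Lemma l2_cvgP (u : nat -> nat -> R[i]) g : l2_cvg u g <->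
  (forall e : R, 0 < e -> exists N, forall k, (N <= k)%N ->
    (l2sq (seqB (u k) g) <= e%:E)%E).
Proof. by apply: ge0_cvge0P => n; exact: l2sq_ge0. Qed.

Lemma l2sq_seqBC u v : l2sq (seqB u v) = l2sq (seqB v u).
Proof. by rewrite !l2sqE; apply: eq_eseriesr => n _; rewrite /seqB sqmodBC. Qed.

Lemma semibounded_toeplitz : semibounded_form (finite_seqs R) (toeplitz_form w).
Proof.
move=> u fu; have [-> _] := toeplitz_form_wnorm w_L1 fu; split => //=.
rewrite -/(energy u) energyE// -parseval_l2sq//.
by apply: wnorm1_le_weight => //; exact: cmeasurable_finite_trig.
Qed.

(** The case F = 0 of [form_cauchy_cvg], with L^2(m) convergence supplied by Parseval. *)
Lemma closable_toeplitz : closable_form (finite_seqs R) (toeplitz_form w).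
Proof.
move=> u fu /l2_cvgP u0 cu.
have mt := @cmeasurable_finite_trig R.
have H := @form_cauchy_cvg (fun=> 0) u (cmeasurable_cst _ _) fu cu.
have N0 V k : wnorm V (fun x => 0 - finite_trig (u k) x) = wnorm V (finite_trig (u k)).
  by apply: eq_integral => x _; rewrite sub0r sqmodN.
have {}H e : 0 < e -> exists N, forall k, (N <= k)%N -> energy (u k) <= e.
  move=> e0; have [|N NP] := H _ e e0.
    move=> d d0; have [N NP] := u0 _ d0; exists N => k Nk.
    rewrite N0 parseval_l2sq//; apply: le_trans (NP k Nk).
    by apply: l2sq_le => n; rewrite /seqB subr0.
  by exists N => k /NP; rewrite N0 -energyE// lee_fin.
apply/cvgrPdist_le => e e0.
have [N NP] := H (e ^+ 2) (exprn_gt0 _ e0); exists N => // k /NP Ek.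
rewrite /= sub0r normrN ger0_norm ?sqrtr_ge0//.
by rewrite -(@ler_pXn2r _ 2%N) ?nnegrE ?sqrtr_ge0 ?(ltW e0)// form_norm_sqr.
Qed.

Lemma analytic_energyE g : l2 R g ->
  analytic_energy w g = wnorm W (fun x => calA g (circ x)).
Proof.
move=> gl2; have /is_L2_sumE[mf _] := calA_is_L2_sum gl2.
rewrite -wnorm_weight// /analytic_energy /circle_integral circle_paramE.
by apply: eq_integral => x _; rewrite cabs_sqr.
Qed.

Lemma closure_approx_calA g (u : nat -> nat -> R[i]) : l2 R g ->
  closure_approx (finite_seqs R) (toeplitz_form w) u g ->
  forall e : R, 0 < e -> exists N, forall k, (N <= k)%N ->
    (wnorm W (fun x => calA g (circ x) - finite_trig (u k) x)%R <= e%:E)%E.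
Proof.
move=> gl2 [fu cu /l2_cvgP ug]; have /is_L2_sumE[mf _] := calA_is_L2_sum gl2.
apply: form_cauchy_cvg => // e e0.
have e2 : 0 < e / 2 by rewrite divr_gt0.
have [N NP] := ug _ e2; exists N => k Nk.
apply: le_trans (calA_finite_trig gl2 (fu k)) _.
by rewrite -lee_pdivlMl// -EFinM mulrC l2sq_seqBC NP.
Qed.

Lemma closure_approx_energy g (u : nat -> nat -> R[i]) : l2 R g ->
  closure_approx (finite_seqs R) (toeplitz_form w) u g ->
  (analytic_energy w g < +oo)%E.
Proof.
move=> gl2 ug; have [N /(_ N (leqnn _)) NP] := closure_approx_calA gl2 ug ltr01.
have [fu _ _] := ug.
have /is_L2_sumE[mf _] := calA_is_L2_sum gl2.
have mt := @cmeasurable_finite_trig R.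
rewrite analytic_energyE//.
apply: (@le_lt_trans _ _ (2%R%:E * wnorm W (fun x => calA g (circ x)
  - finite_trig (u N) x)%R +
   2%R%:E * wnorm W (finite_trig (u N)))%E).
  apply: wnorm_le_comb => //; first exact: cmeasurableB.
  move=> x Dx; rewrite !mulrA -mulrDl ler_wpM2r ?W0//.
  apply: le_trans (sqmodD_le _ _); rewrite [leRHS](_ : _ = sqmod (calA g (circ x)))//.
  by congr sqmod; ring.
rewrite -energyE//; apply: (@le_lt_trans _ _ (2%R%:E * 1%:E + 2%R%:E * (energy (u N))%:E)%E).
  by rewrite leeD2r// lee_wpmul2l.
by rewrite -!EFinM -EFinD ltry.
Qed.

Lemma closure_approx_limit g (u : nat -> nat -> R[i]) : l2 R g ->
  (analytic_energy w g < +oo)%E ->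
  closure_approx (finite_seqs R) (toeplitz_form w) u g ->
  cabs (toeplitz_form w (u k) - (fine (analytic_energy w g))%:C) @[k --> \oo] --> (0 : R).
Proof.
move=> gl2 gfin ug; have H := closure_approx_calA gl2 ug; have [fu _ _] := ug.
have /is_L2_sumE[mf _] := calA_is_L2_sum gl2.
have mt := @cmeasurable_finite_trig R.
set b := fine _.
have bE : wnorm W (fun x => calA g (circ x)) = b%:E.
  by rewrite -analytic_energyE// fineK// ge0_fin_numE// analytic_energyE// wnorm_ge0.
have b0 : 0 <= b by rewrite -lee_fin -bE wnorm_ge0.
have cE k : cabs (toeplitz_form w (u k) - b%:C) = `|energy (u k) - b|.
  have [-> _] := toeplitz_form_wnorm w_L1 (fu k).
  by rewrite -rmorphB/= cabs_sqrt /sqmod/= expr0n addr0 sqrtr_sqr.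
under eq_fun do rewrite cE.
have cmp k (d e : R) : 0 < d ->
    (wnorm W (fun x => calA g (circ x) - finite_trig (u k) x)%R <= e%:E)%E ->
    energy (u k) <= (1 + d) * b + (1 + d^-1) * e /\
    b <= (1 + d) * energy (u k) + (1 + d^-1) * e.
  move=> d0 de; have d1 : 0 <= 1 + d by rewrite addr_ge0// ltW.
  have d2 : 0 <= 1 + d^-1 by rewrite addr_ge0// invr_ge0 ltW.
  have mB : cmeasurable D (fun x => calA g (circ x) - finite_trig (u k) x)
    by exact: cmeasurableB.
  split; rewrite -lee_fin EFinD !EFinM -bE energyE//.
    apply: (@le_trans _ _ ((1 + d)%:E * wnorm W (fun x => calA g (circ x)) +
        (1 + d^-1)%:E * wnorm W (fun x => calA g (circ x) - finite_trig (u k) x)%R)%E).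
      apply: wnorm_le_comb => // x Dx; rewrite !mulrA -mulrDl ler_wpM2r ?W0//.
      by rewrite [sqmod (_ - _)]sqmodBC sqmodB_le.
    by rewrite leeD2l// lee_wpmul2l.
  apply: (@le_trans _ _ ((1 + d)%:E * wnorm W (finite_trig (u k)) +
      (1 + d^-1)%:E * wnorm W (fun x => calA g (circ x) - finite_trig (u k) x)%R)%E).
    apply: wnorm_le_comb => // x Dx; rewrite !mulrA -mulrDl ler_wpM2r ?W0//.
    by rewrite sqmodB_le.
  by rewrite leeD2l// lee_wpmul2l.
apply/cvgrPdist_le => e e0.
(* The comparison with d = 1 and error at most 1 bounds the energies by K. The small [d] then keeps
   the relative errors below e/2, and [c] keeps the additive error below e/2. *)
pose K := 2 * b + 2.
have K0 : 0 < K by rewrite ltr_wpDl// mulr_ge0.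
pose d := e / 2 / K.
have d0 : 0 < d by rewrite !divr_gt0.
pose c := Num.min 1 (e / 2 / (1 + d^-1)).
have dV : 0 < 1 + d^-1 by rewrite addr_gt0// invr_gt0.
have c0 : 0 < c by rewrite lt_min ltr01 !divr_gt0.
have [N NP] := H _ c0; exists N => // k /NP Nk.
have [h1 _] := cmp k 1 c ltr01 Nk.
have [h2 h3] := cmp k d c d0 Nk.
have c1 : c <= 1 by rewrite ge_min lexx.
have ce : (1 + d^-1) * c <= e / 2.
  by rewrite mulrC -ler_pdivlMr// ge_min lexx orbT.
have EK : energy (u k) <= K by move: h1; rewrite invr1 /K; lra.
have bK : b <= K by rewrite /K; lra.
have dK : d * K = e / 2 by rewrite /d divfK// gt_eqF.
have dE : d * energy (u k) <= e / 2 by rewrite -dK ler_wpM2l// ltW.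
have db : d * b <= e / 2 by rewrite -dK ler_wpM2l// ltW.
rewrite /= sub0r normrN normr_id ler_norml; apply/andP; split; lra.
Qed.

Lemma L1_trig_le g (P : R[i] -> R) (e : R) : l2 R g -> 0 < e ->
  (forall z, P z ^+ 2 <= sqmod z) ->
  (forall F, cmeasurable D F -> measurable_fun D (fun x => P (F x))) ->
  exists M0, forall M, (M0 <= M)%N ->
    \int[mu]_(x in D) `|P (trig g M x - calA g (circ x))| <= e.
Proof.
move=> gl2 e0 Pz mP; have /is_L2_sumE[mf cf] := calA_is_L2_sum gl2.
have mD : measurable D by [].
have /(ge0_cvge0P _).1 := cf.
move=> /(_ (fun n => wnorm_ge0 _ (fun _ _ => ler01))) {}cf.
have e2 : 0 < e / 2 by rewrite divr_gt0.
(* With a = e/2 and squared error (e/2)^2, [integral_norm_le_sqr] yields e/2 + e/2, the interval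
   having measure 1. *)
have [M0 MP] := cf _ (exprn_gt0 2 e2); exists M0 => M /MP le.
have mB : cmeasurable D (fun x => trig g M x - calA g (circ x)).
  by apply: cmeasurableB => //; exact: cmeasurable_trig.
have H := @integral_norm_le_sqr _ _ R mu D mD _ _ (mP _ mB) e2.
have {}H : (\int[mu]_(x in D) `|P (trig g M x - calA g (circ x))|%:E <= e%:E)%E.
  apply: le_trans H _.
  rewrite [X in (_ * X + _ <= _)%E](@lebesgue_measure_co01 R) mule1.
  apply: (@le_trans _ _ ((e / 2)%:E + ((e / 2)^-1)%R%:E * ((e / 2) ^+ 2)%:E)%E).
    rewrite leeD2l// lee_wpmul2l ?lee_fin ?invr_ge0 ?(ltW e2)//.
    apply: le_trans le; apply: ge0_le_integral => //.
    - by move=> x _; rewrite lee_fin sqr_ge0.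
    - by apply/measurable_EFinP; apply: measurable_funX; exact: mP.
    - by apply: measurable_sqmodM => //; apply: cmeasurableB => //;
      exact: cmeasurable_trig.
    - by move=> x _; rewrite lee_fin mulr1 [leRHS]sqmodBC Pz.
  rewrite -EFinM -EFinD (_ : e / 2 + _ = e)//.
  by field; rewrite gt_eqF.
rewrite -lee_fin /Rintegral fineK// ge0_fin_numE ?(le_lt_trans H) ?ltry//.
by apply: integral_ge0 => x _; rewrite lee_fin.
Qed.

Lemma bounded_approximation g : muckenhoupt w -> l2 R g ->
  (analytic_energy w g < +oo)%E ->
  exists B : R, forall e : R, 0 < e -> exists u,
    [/\ finite_seqs R u, (l2sq (seqB u g) <= e%:E)%E & energy u <= B].
Proof.
move=> w_A2 gl2 gfin; have /is_L2_sumE[mf cf] := calA_is_L2_sum gl2.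
rewrite analytic_energyE// in gfin.
have [C CP] := muckenhoupt_arc_integral w_L1 w_ge1 w_A2.
have iF : mu.-integrable D (EFin \o (fun x => sqmod (calA g (circ x)) * W x)).
  apply/integrableP; split; first exact: measurable_sqmodM.
  rewrite (_ : (\int[mu]_(x in D) _)%E = wnorm W (fun x => calA g (circ x)))//.
  by apply: eq_integral => x; rewrite inE => /W0 ?; rewrite /= ger0_norm// mulr_ge0//
    sqmod_ge0.
exists (8 * C * \int[mu]_(x in D) (sqmod (calA g (circ x)) * W x) +
        16 * \int[mu]_(x in D) W x) => e e0.
have [N0 NP] := l2sq_smooth_cvg gl2 e0.
(* At least two cells, so that the two halves of an arc do not overlap and the Muckenhoupt bound
   applies. *)
pose N := maxn N0 2.
have N1 : (1 < N)%N by rewrite leq_maxr.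
have NV : 0 < (N%:R : R)^-1 by rewrite invr_gt0 ltr0n ltnW.
have [M0 MP] := NP N (leq_maxl _ _).
have ReP (z : R[i]) : Re z ^+ 2 <= sqmod z by rewrite /sqmod lerDl sqr_ge0.
have ImP (z : R[i]) : complex.Im z ^+ 2 <= sqmod z by rewrite /sqmod lerDr sqr_ge0.
have [M1 M1P] := @L1_trig_le g Re _ gl2 NV ReP (fun F mF => mF.1).
have [M2 M2P] := @L1_trig_le g (@complex.Im R) _ gl2 NV ImP (fun F mF => mF.2).
(* M depends on N and secures three things: closeness to g in l^2, and an L^1 error of at most 1/N
   for the real and for the imaginary part. The energy bound involves neither N nor M. *)
pose M := maxn M0 (maxn M1 M2).
have sM : supported_below M (smooth N M g) by exact: trunc_supported.
exists (smooth N M g); split.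
- by apply/finite_seqsP; exists M.
- by apply: MP; exact: leq_maxl.
rewrite -lee_fin energyE ?(finite_trigE sM); last by apply/finite_seqsP; exists M.
apply: wnorm_smooth_le => //.
- exact: integrable_weight.
- by move=> x _; exact: weight_ge1.
- exact: ltnW.
- by apply: M1P; rewrite !leq_max leqnn orbT.
- by apply: M2P; rewrite !leq_max leqnn !orbT.
- by move=> j jN; exact: CP.
Qed.

Lemma closure_approx_exists g : muckenhoupt w -> l2 R g ->
  (analytic_energy w g < +oo)%E ->
  exists u : nat -> nat -> R[i], closure_approx (finite_seqs R) (toeplitz_form w) u g.
Proof.
move=> w_A2 gl2 gfin; have [B BP] := bounded_approximation w_A2 gl2 gfin.
have [v [fv vg cv]] := minimizing_sequence energy_ge0 energy_parallelogram BP.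
exists v; split => //; first exact/form_cauchyP.
apply/l2_cvgP => e e0; exists (Num.bound e^-1) => k ek.
apply: le_trans (vg k) _; rewrite lee_fin -[leRHS]invrK lef_pV2 ?posrE ?invr_gt0 ?ltr0n//.
have eV : 0 <= e^-1 by rewrite invr_ge0 ltW.
by rewrite (le_trans (ltW (archi_boundP eV)))// ler_nat (leq_trans ek).
Qed.

End closure.

Theorem theorem2p10 (R : realType) (w : R[i] -> R)
    (w_L1 : circle_integrable w)
    (w_ge1 : circle_ae (fun z => 1 <= w z))
    (w_A2 : muckenhoupt w) :
  is_form_closure (finite_seqs R) (toeplitz_form w)
    [set g | l2 R g /\ (analytic_energy w g < +oo)%E]
    (fun g => (fine (analytic_energy w g))%:C).
Proof.
split.
- exact: semibounded_toeplitz.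
- exact: closable_toeplitz.
- apply/seteqP; split => g [gl2].
    by move=> [u ug]; split => //; exact: closure_approx_energy ug.
  by move=> gfin; split => //; exact: closure_approx_exists.
- by move=> g u [gl2 gfin]; exact: closure_approx_limit.
Qed.
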